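(* Let $H$ be an irreducible connected $4$-uniform hypergraph with $\rho(H)\le 6\sqrt[4]{2+\sqrt5}$. Then $H$ is a hypertree with no vertex having degree more than three and no edge incident to more than $4$ other edges. The hypergraph $H$ belongs to one of the following two categories: (Open $4$-quipu) $H$ is a hypertree with all branching vertices and all branching edges ($3$-branching or $4$-branching) lying on a path. Moreover, there are at most two $3$-branching vertices (or two $4$-branching edges). A $4$-branching edge (or a branching vertex) cannot lie (on this path) between two $3$-branching edges, or between a $3$-branching edge and another $4$-branching edge (or a branching vertex). In addition, each $4$-branching edge is attached by three paths of length $1$, $1$, and $k$ ($k\in\{1,2,3\}$) respectively. ($4$-dagger) $H$ is one of the following hypergraphs: $H^{(4)}_{1,2,2,2}$, $H^{(4)}_{1,2,2,3}$, $H^{(4)}_{1,1,4,4}$, $H^{(4)}_{1,1,4,5}$, and $H^{(4)}_{1,1,k,l}$ ($1\le k\le 3$ and $k\le l$).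
   Context: An $r$-uniform hypergraph $H$ is a pair $(V,E)$ with $V$ a finite vertex set and $E\subset\binom{V}{r}$. The degree $d_v$ of a vertex $v$ is the number of edges containing it. The spectral radius of an $r$-uniform hypergraph on $n$ vertices is $$\rho(H)=r!\max_{x\in\mathbb{R}^n_{\ge 0},\,x\ne 0}\frac{\sum_{\{i_1,\dots,i_r\}\in E(H)}x_{i_1}\cdots x_{i_r}}{\sum_{i=1}^n x_i^r}.$$ A walk is a sequence $v_0e_1v_1e_2\ldots v_l$ of vertices and edges with $v_{i-1},v_i\in e_i$ for $1\le i\le l$; its length is the number of edges. It is a path if all vertices and edges on it are distinct; it is closed if $v_l=v_0$; a closed walk is a cycle if all its vertices and edges (apart from $v_l=v_0$) are distinct. A hypergraph is connected if any two vertices are joined by a path; a hypertree is a connected acyclic hypergraph. An $r$-uniform hypergraph $H$ is extended from an $(r-1)$-uniform hypergraph $H'$ if it is obtained by adding one new vertex to each edge of $H'$ (a different new vertex for each edge). $H$ is irreducible if it is not extended from any $(r-1)$-uniform hypergraph; equivalently, $H$ contains an edge all of whose vertices have degree greater than $1$. For $k\ge 3$, a $k$-branching vertex is a vertex incident to $k$ edges, and a $k$-branching edge is an edge that contains no branching vertex but is adjacent to (shares a vertex with) exactly $k$ other edges. A $3$-branching vertex is simply called a branching vertex. An edge is incident to another edge if the two share a vertex. As a hypergraph, a $4$-uniform path ($4$-path) of length $l$ consists of $l$ edges $e_1,\dots,e_l$ of size $4$ such that consecutive edges share exactly one vertex, non-consecutive edges are disjoint, and the shared vertices are distinct. Attaching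 such a path to an edge $F$ means identifying an end vertex of the path (a degree-one vertex of $e_1$) with a vertex of $F$. For $1\le i\le j\le k\le l$, the $4$-dagger $H^{(4)}_{i,j,k,l}$ is the $4$-uniform hypergraph obtained from a single edge $F=\{v_1,v_2,v_3,v_4\}$ by attaching four (otherwise disjoint) $4$-paths of lengths $i,j,k,l$ at $v_1,v_2,v_3,v_4$ respectively; $F$ is its $4$-branching edge. *)

(* Defs.v *)
(* MathComp / MathComp-Analysis. *)
From HB Require Import structures.
From mathcomp Require Import all_boot all_order all_algebra.
From mathcomp Require Import classical_sets reals exp.
(* Restores the finite-set meaning of set0, shadowed by classical_sets. *)
From mathcomp Require Import finset.

Set Implicit Arguments.
Unset Strict Implicit.
Unset Printing Implicit Defensive.

Import Order.TTheory GRing.Theory Num.Theory.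

Record uhypergraph (r : nat) (V : finType) := UHypergraph {
  edges : {set {set V}};
  uniform : forall e, e \in edges -> #|e| = r
}.

Section Basics.
Variables (r : nat) (V : finType) (H : uhypergraph r V).

Definition degree (v : V) : nat := #|[set e in edges H | v \in e]|.

Definition incident_edges (e : {set V}) : {set {set V}} :=
  [set f in edges H | (f != e) && (f :&: e != set0)].

(* A walk v0 e1 v1 ... el vl is given by v0 and w = [:: (e1, v1); ...; (el, vl)];
   its length is size w. *)
Fixpoint walk (v : V) (w : seq ({set V} * V)) : bool :=
  if w is (e, u) :: w' then [&& e \in edges H, v \in e, u \in e & walk u w']
  else true.

Definition walk_path (v : V) (w : seq ({set V} * V)) : bool :=
  [&& walk v w, uniq (v :: unzip2 w) & uniq (unzip1 w)].

(* The degenerate closed walks v and v e v are not cycles; two edges sharing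
   at least two vertices do form a cycle (of length 2). *)
Definition walk_cycle (v : V) (w : seq ({set V} * V)) : bool :=
  [&& walk v w, last v (unzip2 w) == v, uniq (unzip2 w), uniq (unzip1 w)
    & 1 < size w].

Definition connected : Prop :=
  forall u v, exists w, walk_path u w /\ last u (unzip2 w) = v.

Definition acyclic : Prop := forall v w, ~~ walk_cycle v w.

Definition hypertree : Prop := connected /\ acyclic.

Definition branching_vertex (k : nat) (v : V) : bool := degree v == k.

Definition branching_edge (k : nat) (e : {set V}) : bool :=
  [&& e \in edges H, [forall v in e, ~~ branching_vertex 3 v]
    & #|incident_edges e| == k].

End Basics.

Section SpectralRadius.
Local Open Scope ring_scope.
Variables (R : realType) (r : nat) (V : finType) (H : uhypergraph r V).

Definition edge_quotient (x : V -> R) : R :=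
  (\sum_(e in edges H) \prod_(v in e) x v) / (\sum_v x v ^+ r).

(* For 0 < r and V nonempty the quotient is continuous and homogeneous of
   degree 0 in x when all edges have r vertices, so by compactness of the
   nonnegative part of the unit sphere this supremum is a maximum. *)
Definition spectral_radius : R :=
  r`!%:R * sup [set edge_quotient x | x in
    [set x : V -> R | (forall v, 0 <= x v) /\ exists v, x v != 0]]%classic.

End SpectralRadius.

Definition isomorphic (r : nat) (V W : finType)
    (H : uhypergraph r V) (K : uhypergraph r W) : Prop :=
  exists2 f : V -> W, bijective f & edges K = [set f @: e | e : {set V} in edges H].

Section Extension.
Variables (r : nat) (V : finType) (H : uhypergraph r V).

(* The new vertex added to the edge e is inr e. *)
Definition extension_vertex : finType := (V + {e : {set V} | e \in edges H})%type.

Definition extended_edge (e : {e : {set V} | e \in edges H}) :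
    {set extension_vertex} :=
  inr e |: [set inl v | v in val e].

Definition extension_edges : {set {set extension_vertex}} :=
  [set extended_edge e | e : {e : {set V} | e \in edges H}].

Lemma extension_uniform e : e \in extension_edges -> #|e| = r.+1.
Proof.
case/imsetP=> -[e' e'H] _ ->; rewrite cardsU1 card_imset; last by move=> ? ? [].
rewrite (uniform e'H) (_ : _ \notin _ = true) //.
by apply/imsetP => -[].
Qed.

Definition extension : uhypergraph r.+1 extension_vertex :=
  UHypergraph extension_uniform.

End Extension.

Definition irreducible (r : nat) (V : finType) (H : uhypergraph r.+1 V) : Prop :=
  ~ exists (W : finType) (K : uhypergraph r W), isomorphic H (extension K).

(* The sequence of edges s = [:: e1; ...; el] is an r-uniform path. *)
Definition uniform_path (r : nat) (V : finType) (s : seq {set V}) : Prop :=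
  let e := nth set0 s in
  [/\ forall i, i < size s -> #|e i| = r,
      forall i, i.+1 < size s -> #|e i :&: e i.+1| = 1,
      forall i j, i.+1 < j < size s -> [disjoint e i & e j]
    & forall i j, i < j -> j.+1 < size s ->
        e i :&: e i.+1 != e j :&: e j.+1].

Section Attachment.
Variables (r : nat) (V : finType) (H : uhypergraph r V).

(* H arises by identifying an end vertex of the uniform path s with the vertex v
   of F: v has degree one in s and lies in its first edge, and v is the only
   vertex that s shares with the edges of H outside s. *)
Definition attached_path (F : {set V}) (v : V) (s : seq {set V}) : Prop :=
  [/\ uniform_path r s /\ {subset s <= edges H},
      [/\ F \in edges H, F \notin s & v \in F],
      v \in head set0 s /\ (forall e, e \in behead s -> v \notin e)
    & forall e, e \in edges H -> e \notin s ->
        e :&: \bigcup_(f <- s) f \subset [set v] ].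

(* Otherwise disjoint paths s t, of lengths l t, are attached to F at the
   distinct vertices v t. *)
Definition attached_paths (n : nat) (F : {set V}) (l : n.-tuple nat)
    (v : 'I_n -> V) (s : 'I_n -> seq {set V}) : Prop :=
  [/\ injective v,
      forall t, attached_path F (v t) (s t),
      forall t, size (s t) = tnth l t
    & forall t t', t != t' ->
        [disjoint \bigcup_(f <- s t) f & \bigcup_(f <- s t') f] ].

(* For n smaller than the size of F, nothing is required at the other vertices
   of F. *)
Definition has_attached_paths (n : nat) (F : {set V}) (l : n.-tuple nat) : Prop :=
  exists v s, attached_paths F l v s.

End Attachment.

(* H is (up to isomorphism) the 4-dagger with parameters i, j, k, l. *)
Definition is_dagger (V : finType) (H : uhypergraph 4 V) (i j k l : nat) : Prop :=
  exists (F : {set V}) (v : 'I_4 -> V) (s : 'I_4 -> seq {set V}),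
    [/\ attached_paths H F [tuple i; j; k; l] v s,
        forall e, e \in edges H -> e = F \/ exists t, e \in s t
      & forall x, exists2 e, e \in edges H & x \in e].

Section Quipu.
Variables (r : nat) (V : finType) (H : uhypergraph r V).

Definition path_items (v : V) (w : seq ({set V} * V)) : seq (V + {set V}) :=
  inl v :: flatten [seq [:: inr eu.1; inl eu.2] | eu <- w].

Definition before (p : seq (V + {set V})) (a b : V + {set V}) : bool :=
  [&& a \in p, b \in p & index a p < index b p].

Definition between (p : seq (V + {set V})) (a b c : V + {set V}) : bool :=
  (before p a b && before p b c) || (before p c b && before p b a).

Definition is_branching3_edge (x : V + {set V}) : bool :=
  if x is inr e then branching_edge H 3 e else false.

Definition is_branching4_edge_or_vertex (x : V + {set V}) : bool :=
  match x with
  | inl v => branching_vertex H 3 v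
  | inr e => branching_edge H 4 e
  end.

End Quipu.

Definition open_quipu (V : finType) (H : uhypergraph 4 V) : Prop :=
  [/\ hypertree H,
      exists v w, let p := path_items v w in
        [/\ walk_path H v w,
            forall u, branching_vertex H 3 u -> inl u \in p,
            forall e, branching_edge H 3 e || branching_edge H 4 e -> inr e \in p
          & forall a b c, between p a b c -> is_branching4_edge_or_vertex H b ->
              is_branching3_edge H a ->
              ~~ is_branching3_edge H c /\ ~~ is_branching4_edge_or_vertex H c],
      (* "at most two branching vertices (or 4-branching edges)": both kinds are
         counted together *)
      #|[set v | branching_vertex H 3 v]| + #|[set e | branching_edge H 4 e]| <= 2
    & forall F, branching_edge H 4 F ->
        exists2 k, k \in [:: 1; 2; 3] & has_attached_paths H F [tuple 1; 1; k] ].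

(* Main.v *)
From mathcomp Require Import boolp topology normedtype derive realfun.
From mathcomp Require Import function_spaces.
Require Import Defs.
From mathcomp Require Import all_boot all_order all_algebra.
From mathcomp Require Import classical_sets reals exp.
From mathcomp Require Import ring lra.
From mathcomp Require Import fintype finset.

Import Order.TTheory GRing.Theory Num.Theory.
Import numFieldNormedType.Exports.

Set Implicit Arguments.
Unset Strict Implicit.
Unset Printing Implicit Defensive.

(** Let g = (sqrt 5 - 1) / 2, so that g^2 = 1 - g, and put alpha = 2 g - 1. Then
    alpha = g^3 = 1 / (2 + sqrt 5).

    A positive vector x maximizing the quotient that defines the spectral
    radius rho labels the incidence of a vertex v and an edge e by
    B(v, e) = (product of the x_u, u in e) / (lambda x_v^4), where
    lambda = rho / 6. The labels at a vertex sum to at most 1, and those on an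
    edge multiply to lambda^-4 >= alpha (threshold_subnormal). All the rest
    follows from these local inequalities: if v belongs to two edges, a large
    label in one of them leaves little to the other, and a small label in an
    edge forces the others to be large. Along a path, labels are transported by
    t |-> alpha / (1 - t), whose fixed points are 1 - g and g.

    Two edges sharing three vertices violate the inequalities, so irreducibility
    yields an edge F all of whose vertices have degree at least 2
    (irreducible_full_edge). Each label of F is then larger than 1 - g, and this
    propagates: a non-backtracking walk from F enters each edge with a label
    less than g and leaves it with a label larger than 1 - g (nbw_label,
    near_label). Such a walk cannot meet itself (no_loop_at_vertex,
    no_loop_at_edge, nbw_root_uniq), so H is a hypertree growing from F
    (rooted_acyclic), and the bounds on degrees and incident edges follow by
    counting labels (degree_le3, incident_le4).

    On the other hand, an edge beyond which something branches takes at least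
    1 - g from the vertex where it is attached, and leaves at most g there
    (beyond_label). Since an edge is entered with less than g and g^3 = alpha,
    at most one of its other vertices leads to a branching item (active_unique),
    none if the edge is 4-branching (branching4_inactive); and nothing branches
    beyond a vertex of degree three (branching_vertex_last). So the branching
    items beyond a vertex of F lie on one path, on which a branching vertex or a
    4-branching edge can only come last (spine). Similarly, at most one vertex
    of F leads to branching items. If none does, H consists of F and four paths,
    and the label of a path of given length decides which lengths are possible:
    H is a dagger (dagger_lengths, no_active_dagger). If one does, the branching
    items form a quipu with F at one end; in a 4-branching edge the vertex that
    leads to the rest has a label at most g, so the three other paths must have
    lengths 1, 1 and at most 3 (quipu_lengths, active_quipu). *)

(** * Walks *)

Lemma last_unzip1 (S T : Type) (x : S) (p : S * T) w :
  last x (unzip1 (p :: w)) = (last p w).1.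
Proof. by rewrite /= last_map. Qed.

Lemma last_unzip2 (S T : Type) (y : T) (p : S * T) w :
  last y (unzip2 (p :: w)) = (last p w).2.
Proof. by rewrite /= last_map. Qed.

Lemma unzip1_cat (S T : Type) (w1 w2 : seq (S * T)) :
  unzip1 (w1 ++ w2) = unzip1 w1 ++ unzip1 w2.
Proof. exact: map_cat. Qed.

Lemma unzip2_cat (S T : Type) (w1 w2 : seq (S * T)) :
  unzip2 (w1 ++ w2) = unzip2 w1 ++ unzip2 w2.
Proof. exact: map_cat. Qed.

Lemma before_pairwise (T : eqType) (r : rel T) (s : seq T) b c :
  pairwise r s -> b \in s -> c \in s -> index b s < index c s -> r b c.
Proof.
elim: s => [|x s IH] //=; case/andP=> /allP rx ps; rewrite !inE.
rewrite ![x == _]eq_sym; case: (eqVneq b x) => [->|bx] /=; case: (eqVneq c x) => //= _.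
  by move=> _ cs _; apply: rx.
by move=> bs cs; rewrite ltnS; apply: IH.
Qed.

Section Walks.
Variables (r : nat) (V : finType) (H : uhypergraph r V).
Implicit Types (e f : {set V}) (v u : V) (w : seq ({set V} * V)).

(** Here e0 is the edge by which v has been reached: with it as a parameter,
    non-backtracking walks can be cut and joined anywhere. *)
Fixpoint nbw e0 v w : bool :=
  if w is (e, u) :: w' then
    [&& e \in edges H, v \in e, e != e0, u \in e, u != v & nbw e u w']
  else true.

Lemma nbw_cons e0 v e u w : nbw e0 v ((e, u) :: w) =
  [&& e \in edges H, v \in e, e != e0, u \in e, u != v & nbw e u w].
Proof. by []. Qed.

Lemma nbw_cat e0 v w1 w2 :
  nbw e0 v (w1 ++ w2) =
  nbw e0 v w1 && nbw (last e0 (unzip1 w1)) (last v (unzip2 w1)) w2.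
Proof.
elim: w1 e0 v => [|[e u] w1 IH] e0 v //=.
by rewrite IH; case: (e \in _); case: (v \in e); case: (e != e0);
  case: (u \in e); case: (u != v).
Qed.

Lemma nbw_walk e0 v w : nbw e0 v w -> walk H v w.
Proof.
elim: w e0 v => [|[e u] w IH] e0 v //= /and5P[-> -> _ -> /andP[_ /IH]].
by [].
Qed.

Lemma nbw_last e0 v e u w (l := last (e, u) w) :
  nbw e0 v ((e, u) :: w) -> (l.1 \in edges H) && (l.2 \in l.1).
Proof.
rewrite {}/l; elim: w e0 v e u => [|[f x] w IH] e0 v e u.
  by move=> /= /and5P[-> _ _ -> _].
by rewrite [nbw _ _ _]/= => /and5P[_ _ _ _ /andP[_ /IH]].
Qed.

(** Only the first edge of w can clash with e0, which may well occur later in w. *)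
Lemma walk_nbw e0 v w : walk H v w -> uniq (v :: unzip2 w) ->
  uniq (unzip1 w) -> ohead (unzip1 w) != Some e0 -> nbw e0 v w.
Proof.
elim: w e0 v => [|[e u] w IH] e0 v // /and4P[eE ve ue wk].
rewrite [unzip2 _]/= [unzip1 _]/= !cons_uniq inE negb_or.
move=> /andP[/andP[vu _] Uv] /andP[ew Ue] e_ne.
rewrite nbw_cons eE ve ue (eq_sym u) vu (contraNneq _ e_ne) => [|->] //=.
by apply: IH => //; case: w ew {wk Uv Ue e_ne} => [|p w] //=; rewrite inE negb_or;
   case/andP=> e_p _; apply: contra e_p => /eqP[->].
Qed.

Fixpoint rev_walk v w : seq ({set V} * V) :=
  if w is (e, u) :: w' then rcons (rev_walk u w') (e, v) else [::].

Lemma rev_walk_edges v w : unzip1 (rev_walk v w) = rev (unzip1 w).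
Proof.
elim: w v => [|[e u] w IH] v //=.
by rewrite rev_cons /unzip1 map_rcons -/(unzip1 _) IH.
Qed.

Lemma rev_walk_vertices v w : unzip2 (rev_walk v w) = rev (belast v (unzip2 w)).
Proof.
elim: w v => [|[e u] w IH] v //=.
by rewrite rev_cons /unzip2 map_rcons -/(unzip2 _) IH.
Qed.

Lemma walk_cat v w1 w2 :
  walk H v (w1 ++ w2) = walk H v w1 && walk H (last v (unzip2 w1)) w2.
Proof.
elim: w1 v => [|[e u] w1 IH] v //=; rewrite IH.
by case: (e \in _); case: (v \in e); case: (u \in e).
Qed.

Lemma last_rev_walk v w : last (last v (unzip2 w)) (unzip2 (rev_walk v w)) = v.
Proof. by case: w => [|[e u] w] //=; rewrite /unzip2 map_rcons last_rcons. Qed.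

Lemma walk_rev v w : walk H v w -> walk H (last v (unzip2 w)) (rev_walk v w).
Proof.
elim: w v => [|[e u] w IH] v //= /and4P[eE ve ue /IH wk].
by rewrite -cats1 walk_cat wk last_rev_walk /= eE ve ue.
Qed.

(** A cycle has two directions, and at most one of them starts with a given
    edge. *)
Lemma cycle_rev v w : walk_cycle H v w -> walk_cycle H v (rev_walk v w).
Proof.
case/and5P=> wk /eqP lv U2 U1 sz; rewrite /walk_cycle.
have := walk_rev wk; have := last_rev_walk v w; rewrite lv => -> ->.
rewrite eqxx /= rev_walk_edges rev_uniq U1 rev_walk_vertices rev_uniq.
have -> : size (rev_walk v w) = size w.
  by rewrite -(size_map fst) -/(unzip1 _) rev_walk_edges size_rev size_map.
rewrite sz !andbT; case/lastP: w lv U2 {wk U1 sz} => [|w [e u]] //=.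
rewrite /unzip2 map_rcons last_rcons /= => -> .
by rewrite belast_rcons rcons_uniq cons_uniq.
Qed.

End Walks.

(** * Acyclic hypergraphs *)

Section Acyclic.
Variables (r : nat) (V : finType) (H : uhypergraph r V).
Hypothesis Hac : acyclic H.
Implicit Types (e f : {set V}) (v u : V).

(** Two common vertices would close a cycle of length two. *)
Lemma acyclic_meet e f v u : e \in edges H -> f \in edges H -> f != e ->
  v \in e -> v \in f -> u \in e -> u \in f -> u = v.
Proof.
move=> eE fE fe ve vf ue uf; apply/eqP; apply/negPn/negP => uv.
have /negP[] := Hac v [:: (e, u); (f, v)].
by rewrite /walk_cycle /= eE fE ve vf ue uf eqxx !inE uv eq_sym fe.
Qed.

Lemma acyclic_card_meet e f : e \in edges H -> f \in edges H -> f != e ->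
  #|f :&: e| = (f :&: e != set0).
Proof.
move=> eE fE fe; have [->|[v]] := set_0Vmem (f :&: e).
  by rewrite cards0 eqxx.
rewrite inE => /andP[vf ve]; have -> : f :&: e = [set v].
  apply/setP => u; rewrite !inE; apply/andP/eqP => [[uf ue]|->] //.
  exact: (acyclic_meet eE fE fe).
by rewrite cards1; have /set0Pn -> : exists x, x \in [set v] by exists v; rewrite inE.
Qed.

Lemma degree_sum e u : e \in edges H -> u \in e ->
  (degree H u).-1 = \sum_(f in edges H | f != e) (u \in f).
Proof.
move=> eE ue; rewrite /degree (cardsD1 e) !inE eE ue /=.
rewrite -sum1_card [LHS]big_mkcond [RHS]big_mkcond /=.
apply: eq_bigr => f _; rewrite !inE.
by case: (f \in edges H); case: (f == e); case: (u \in f).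
Qed.

(** Two edges share at most one vertex, so each incident edge is counted at
    exactly one vertex of e. *)
Lemma card_incident e : e \in edges H ->
  #|incident_edges H e| = \sum_(u in e) (degree H u).-1.
Proof.
move=> eE; rewrite (eq_bigr (fun u => \sum_(f in edges H | f != e) (u \in f))%N); last first.
  by move=> u ue; apply: degree_sum.
rewrite exchange_big /= -sum1_card.
rewrite [LHS]big_mkcond [RHS]big_mkcond /=; apply: eq_bigr => f _.
rewrite inE; case: ifP; last first.
  move=> h; case: ifP => // /andP[fE fe].
  move: h; rewrite fE fe /= => /negbFE /eqP h; rewrite big1 // => u ue.
  by have := in_set0 u; rewrite -h inE ue andbT => ->.
case/and3P=> fE fe h; rewrite fE fe /=.
have := acyclic_card_meet eE fE fe; rewrite h /= => <-.
rewrite -sum1_card big_mkcond [RHS]big_mkcond /=.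
by apply: eq_bigr => u _; rewrite inE; case: (u \in e); case: (u \in f).
Qed.
End Acyclic.

(** * What lies beyond an edge *)

Section Beyond.
Variables (r : nat) (V : finType) (H : uhypergraph r V).
Implicit Types (e f : {set V}) (v u : V) (x : V + {set V}).

Definition branching_item x :=
  is_branching3_edge H x || is_branching4_edge_or_vertex H x.

(** What can be reached by entering the edge e at v and never turning back. The
    items are those of the path of a quipu: inl for vertices, inr for edges. *)
Inductive beyond : V -> {set V} -> V + {set V} -> Prop :=
| BeyondEdge v e : beyond v e (inr e)
| BeyondVertex v e u : u \in e -> u != v -> beyond v e (inl u)
| BeyondNext v e u f x : u \in e -> u != v -> f \in edges H -> u \in f ->
    f != e -> beyond u f x -> beyond v e x.

Definition active e u := degree H u = 3%N \/
  exists f x, [/\ f \in edges H, u \in f, f != e, beyond u f x & branching_item x].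

(** The list path_items without its starting vertex. *)
Definition items (w : seq ({set V} * V)) : seq (V + {set V}) :=
  flatten [seq [:: inr eu.1; inl eu.2] | eu <- w].

Lemma nbw_beyond e0 v e u w : nbw H e0 v ((e, u) :: w) ->
  beyond v e (inr (last (e, u) w).1) /\ beyond v e (inl (last (e, u) w).2).
Proof.
elim: w e0 v e u => [|[f y] w IH] e0 v e u.
  by move=> /= /and5P[_ _ _ ue /andP[uv _]]; split; constructor.
rewrite nbw_cons => /and5P[eE ve _ ue /andP[uv N]].
have [h1 h2] := IH _ _ _ _ N; move: N => /= /and5P[fE uf fe _ _].
by split; apply: (@BeyondNext v e u f).
Qed.

Lemma beyondP v e x : beyond v e x -> branching_item x ->
  x = inr e \/ exists2 u, (u \in e) && (u != v) & active e u /\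
    (x = inl u /\ degree H u = 3%N \/
     exists f, [/\ f \in edges H, u \in f, f != e & beyond u f x]).
Proof.
case=> {v e x} [v e|v e u ue uv|v e u f x ue uv fE uf fe b] br; first by left.
  right; exists u; first by rewrite ue uv.
  by move/eqP: br => /= d3; split; left.
right; exists u; first by rewrite ue uv.
by split; right; exists f; [exists x|].
Qed.
(** The order condition on the items of a quipu, read outwards from its root. *)
Definition may_precede (b c : V + {set V}) :=
  ~~ (is_branching4_edge_or_vertex H b && branching_item c).

End Beyond.

(** * Paths hanging from an edge *)

Section HangingPath.
Variables (r : nat) (V : finType) (H : uhypergraph r V).
Implicit Types (e f : {set V}) (v u : V) (w : seq ({set V} * V)).
Local Notation E := (edges H).
Local Notation nbw := (nbw H).

(** The walk w exhausts what lies beyond v: the vertices where it does not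
    change edges have degree one, the others degree two. *)
Fixpoint hanging_path v w : Prop :=
  if w is (e, u) :: w' then
    (forall x h, x \in e -> x != v -> h \in E -> x \in h ->
       h = e \/ x = u /\ ohead (unzip1 w') = Some h) /\ hanging_path u w'
  else True.

(** Adjacency in the hypergraph is adjacency in the sequence. With the
    distinctness of the edges, this contains everything that a uniform path
    attached to an edge has to satisfy. *)
Lemma hanging_path_local e0 v w (s := unzip1 w) :
  nbw e0 v w -> hanging_path v w -> uniq s ->
  forall i x h, i < size s -> x \in nth set0 s i -> x != v -> h \in E ->
  x \in h -> exists j, [/\ j < size s, h = nth set0 s j, j <= i.+1 & i <= j.+1].
Proof.
rewrite {}/s; elim: w e0 v => [|[e u] w IH] e0 v //.
rewrite nbw_cons => /and5P[eE ve _ ue /andP[uv N]] [T T'] /= /andP[ew U].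
have first x h : x \in e -> x != v -> h \in E -> x \in h ->
    exists j, [/\ j < (size (unzip1 w)).+1, h = nth set0 (e :: unzip1 w) j & j <= 1].
  move=> xe xv hE xh; case: (T x h xe xv hE xh) => [->|[_ hw]]; first by exists 0.
  by exists 1; case: (w) hw => [|p w'] //= [->].
case=> [|i] x h /=.
  by move=> _ xe xv hE xh; have [j [j1 j2 j3]] := first _ _ xe xv hE xh; exists j.
rewrite ltnS => iw xi xv hE xh.
have [xu|xu] := eqVneq x u; last first.
  have [j [j1 j2 j3 j4]] := IH _ _ N T' U i x h iw xi xu hE xh.
  by exists j.+1; split.
have siE : nth set0 (unzip1 w) i \in E.
  move: (nth set0 _ _) (mem_nth set0 iw) => f; move: N {T T' U IH ew iw first xi}.
  elim: (w) (e) (u) => [|[f' y] w' IH'] e' y' //.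
  rewrite nbw_cons => /and5P[fE _ _ _ /andP[_ N]]; rewrite inE => /orP[/eqP->|] //.
  exact: IH' N.
have i0 : i = 0.
  have := first _ _ ue uv siE; rewrite -xu => /(_ xi)[[|[|j]]] [j1 j2 // _].
    by case/negP: ew; rewrite -[e]/(nth set0 (e :: unzip1 w) 0) -j2 mem_nth.
  by apply/eqP; rewrite -(nth_uniq set0 iw _ U) //= j2 eqxx.
have := first _ _ ue uv hE; rewrite -xu => /(_ xh)[j [j1 j2 j3]].
by exists j; rewrite i0; split=> //; apply: leq_trans j3 _.
Qed.

Lemma nbw_edges e0 v w e : nbw e0 v w -> e \in unzip1 w -> e \in E.
Proof.
elim: w e0 v => [|[f y] w IH] e0 v //.
rewrite nbw_cons => /and5P[fE _ _ _ /andP[_ N]].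
by rewrite inE => /orP[/eqP->|] //; apply: IH N.
Qed.

Lemma nbw_link e0 v w i (s := unzip1 w) : nbw e0 v w -> i.+1 < size s ->
  exists x, x \in nth set0 s i :&: nth set0 s i.+1.
Proof.
rewrite {}/s; elim: w e0 v i => [|[f y] w IH] e0 v i //.
rewrite nbw_cons => /and5P[_ _ _ yf /andP[_ N]].
case: i => [|i] /=; last by move=> sz; apply: IH N _.
by case: w N {IH} => [|[h z] w] //= /and5P[_ yh _ _ _] _; exists y; rewrite inE yf yh.
Qed.

Section Attach.
Hypothesis Hac : acyclic H.
Variables (e0 : {set V}) (v : V) (w : seq ({set V} * V)).
Let s := unzip1 w.
Hypotheses (e0E : e0 \in E) (ve0 : v \in e0) (w0 : w != [::]).
Hypotheses (N : nbw e0 v w) (T : hanging_path v w) (U : uniq (e0 :: s)).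
Hypothesis v2 : forall h, h \in E -> v \in h -> h = e0 \/ h = head set0 s.

Let Us : uniq s. Proof. by case/andP: U. Qed.
Let e0s : e0 \notin s. Proof. by case/andP: U. Qed.
Let s_gt0 : 0 < size s. Proof. by rewrite /s size_map; case: (w) w0. Qed.
Let sE i : i < size s -> nth set0 s i \in E.
Proof. by move=> i_s; apply: (nbw_edges N); apply: mem_nth. Qed.

Let v_behead i : 0 < i < size s -> v \notin nth set0 s i.
Proof.
case/andP=> i0 i_s; apply/negP => /(v2 (sE i_s))[] h.
  by case/negP: e0s; rewrite -h mem_nth.
move: h; rewrite -nth0 => /eqP; rewrite nth_uniq // => /eqP h.
by rewrite h in i0.
Qed.

Let s_disjoint i j : i.+1 < j < size s -> [disjoint nth set0 s i & nth set0 s j].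
Proof.
case/andP=> ij js; apply/pred0P => x /=; apply/negP => /andP[xi xj].
have i_s : i < size s by apply: ltn_trans js; apply: ltn_trans ij.
have xv : x != v.
  apply: contraTneq xj => ->; apply: v_behead; rewrite js andbT.
  by apply: leq_trans ij.
have [k [ks /eqP jk k1 _]] := hanging_path_local N T Us i_s xi xv (sE js) xj.
move: jk; rewrite nth_uniq // => /eqP jk.
by move: ij; rewrite jk ltnNge k1.
Qed.

Lemma hanging_path_attached : attached_path H e0 v s.
Proof.
split.
- split; last by move=> e; apply: nbw_edges N.
  have link i : i.+1 < size s -> #|nth set0 s i :&: nth set0 s i.+1| = 1.
    move=> i_s; have i_s' := ltnW i_s; have [x xi] := nbw_link N i_s.
    rewrite (acyclic_card_meet Hac) ?sE //.
      by have /set0Pn -> : exists x, x \in nth set0 s i :&: nth set0 s i.+1 by exists x.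
    by rewrite nth_uniq // -(negbK (_ == _)) neq_ltn ltnSn.
  split=> //.
  - by move=> i i_s; apply: uniform; apply: sE.
  move=> i j ij js; apply/eqP => h.
  have i_s : i.+1 < size s by apply: leq_ltn_trans js; apply: leqW.
  have [x] := nbw_link N i_s; move: (i_s) => _; rewrite -/s => xi.
  have := xi; rewrite h !inE => /andP[_ xj]; move: xi; rewrite inE => /andP[xi _].
  have D : [disjoint nth set0 s i & nth set0 s j.+1].
    by apply: s_disjoint; rewrite ltnS ij js.
  by have := disjointFr D xi; rewrite xj.
- split=> //.
- split; last first.
    move=> e /(nthP set0)[i i_s <-]; rewrite nth_behead; apply: v_behead.
    by move: i_s; rewrite size_behead /=; case: (size s).
  move: w0 N; rewrite /s; case: (w) => [|[f y] w'] // _.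
  by rewrite nbw_cons => /and5P[].
move=> e eE es; apply/subsetP => x; rewrite !inE bigcup_seq.
case/andP=> xe /bigcupP[f /(nthP set0)[i i_s <-] xi].
apply/negPn/negP => xv.
have [j [js ej _ _]] := hanging_path_local N T Us i_s xi xv eE xe.
by case/negP: es; rewrite ej mem_nth.
Qed.

End Attach.

(** Follow s from e0 to its first edge in s', if there is one. The edge just
    before it, or e0, meets s' at v' only; but at v' there are only e0 and
    the first edge of s', and e0 contains v as well. *)
Lemma attached_disjoint e0 v v' s s' :
  attached_path H e0 v s -> attached_path H e0 v' s' -> v != v' ->
  (forall h, h \in E -> v' \in h -> h = e0 \/ h = head set0 s') ->
  [disjoint \bigcup_(f <- s) f & \bigcup_(f <- s') f].
Proof.
move=> [[P sE] [e0E e0s ve0] [vs _] _] [[P' sE'] [_ e0s' ve0'] [vs' _] cl] vv' only.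
have s'0 : head set0 s' \in s'.
  by case: (s') vs' => [|f t] /=; rewrite ?inE ?eqxx.
have touch f : f \in s -> f \notin s' -> v' \notin f.
  move=> fs fs'; apply/negP => /(only f (sE f fs)) [] h.
    by rewrite -h fs in e0s.
  by rewrite h s'0 in fs'.
have meet f x : f \in s -> f \notin s' -> x \in f ->
    x \notin \bigcup_(f <- s') f.
  move=> fs fs' xf; apply/negP => xs'; case/negP: (touch f fs fs').
  have /subsetP/(_ x) := cl f (sE f fs) fs'.
  by rewrite in_setI xf xs' in_set1 => /(_ isT)/eqP <-.
have out i : i < size s -> nth set0 s i \notin s'.
  elim: i => [|i IH] i_s; apply/negP => is'.
    have /subsetP/(_ v) := cl e0 e0E e0s'; rewrite in_setI ve0 bigcup_seq.
    have -> : v \in \bigcup_(f in s') f.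
      by apply/bigcupP; exists (nth set0 s 0); rewrite // nth0.
    by rewrite in_set1 (negbTE vv') => /(_ isT).
  have i_s' := ltnW i_s; case: P => _ /(_ i i_s) c1 _ _.
  have /card_gt0P[x] : 0 < #|nth set0 s i :&: nth set0 s i.+1| by rewrite c1.
  rewrite inE => /andP[xi xi1].
  case/negP: (meet _ x (mem_nth set0 i_s') (IH i_s') xi).
  by rewrite bigcup_seq; apply/bigcupP; exists (nth set0 s i.+1).
apply/pred0P => x /=; apply/negP; rewrite {1}bigcup_seq => /andP[/bigcupP[f fs xf]].
case/(nthP set0): fs xf => i i_s <- xi; apply/negP.
by apply: meet xi; rewrite ?mem_nth ?out.
Qed.
End HangingPath.

Lemma attached_paths_seq r (V : finType) (H : uhypergraph r V) n (e0 : {set V})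
    (l : n.-tuple V) (S : V -> seq {set V}) :
  uniq l -> (forall x, x \in l -> attached_path H e0 x (S x)) ->
  (forall x h, x \in l -> h \in edges H -> x \in h ->
     h = e0 \/ h = head set0 (S x)) ->
  attached_paths H e0 (map_tuple (size \o S) l) (tnth l) (S \o tnth l).
Proof.
move=> U A only; have inj : injective (tnth l) by apply/tuple_uniqP.
split=> //.
- by move=> t; apply: A; apply: mem_tnth.
- by move=> t; rewrite tnth_map.
move=> t t' tt'; apply: attached_disjoint (A _ (mem_tnth t l)) (A _ (mem_tnth t' l)) _ _.
  by rewrite (inj_eq inj).
by move=> h hE lh; apply: only => //; apply: mem_tnth.
Qed.

(** * Labellings *)

Section EdgeVertices.
Variables (V : finType) (H : uhypergraph 4 V).
Implicit Types (e : {set V}) (v : V).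

Lemma edge_enum e v : e \in edges H -> v \in e ->
  exists x y z, [/\ [/\ x \in e, y \in e & z \in e], uniq [:: v; x; y; z]
    & e =i [:: v; x; y; z]].
Proof.
move=> eE ve; have := uniform eE; rewrite (cardsD1 v) ve => -[].
rewrite cardE; case D: (enum _) => [|x [|y [|z []]]] // _; exists x, y, z.
have De u : (u \in [:: x; y; z]) = (u \in e :\ v) by rewrite -D mem_enum.
have ee : e =i [:: v; x; y; z].
  by move=> u; rewrite inE De !inE; case: eqP => // ->.
split=> //; first by rewrite !ee !inE !eqxx !orbT.
by rewrite cons_uniq -D enum_uniq andbT D De !inE eqxx.
Qed.

Lemma edge_other e v : e \in edges H -> v \in e ->
  exists2 u, u \in e & u != v.
Proof.
move=> eE ve; have [x [y [z [[xe _ _] U _]]]] := edge_enum eE ve.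
by exists x => //; move: U; rewrite /= !inE !negb_or eq_sym => /andP[/and3P[]].
Qed.

End EdgeVertices.

(** The alpha-subnormal labellings for alpha = 2 g - 1. The conditions on g make
    it the golden section (sqrt 5 - 1) / 2, for which alpha = g ^+ 3 = 1 /
    (2 + sqrt 5). *)
Record subnormal (R : realFieldType) (V : finType) (H : uhypergraph 4 V)
    (g : R) (B : V -> {set V} -> R) : Prop := Subnormal {
  golden_gt0 : (0 < g)%R;
  golden_eq : (g * g = 1 - g)%R;
  label_gt0 : forall v e, e \in edges H -> v \in e -> (0 < B v e)%R;
  label_sum : forall v, (\sum_(e in edges H | v \in e) B v e <= 1)%R;
  label_prod : forall e, e \in edges H -> (2 * g - 1 <= \prod_(v in e) B v e)%R
}.

Section Labelled.
Variables (R : realFieldType) (V : finType) (H : uhypergraph 4 V).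
Variables (g : R) (B : V -> {set V} -> R).
Hypothesis L : subnormal H g B.
Local Notation E := (edges H).
Local Notation alpha := (2 * g - 1)%R.
Implicit Types (e f : {set V}) (v u : V) (w : seq ({set V} * V)).

Section Inequalities.
Local Open Scope ring_scope.

(** Quotients of consecutive Fibonacci numbers; root_gt depends on exactly this
    lower bound. *)
Lemma golden_bounds : 377 / 610 < g < 89 / 144.
Proof.
have g0 := golden_gt0 L; have g2 := golden_eq L.
by apply/andP; split; nra.
Qed.

Lemma golden_product : (1 - g) * ((2 - 2 * g) * (2 - 2 * g)) = 20 - 32 * g.
Proof.
apply/eqP; rewrite -subr_eq0.
have -> : (1 - g) * ((2 - 2 * g) * (2 - 2 * g)) - (20 - 32 * g) =
    (g * g - (1 - g)) * (16 - 4 * g) by ring.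
by rewrite (golden_eq L) subrr mul0r.
Qed.

Lemma label_sum_seq v (s : seq {set V}) : uniq s ->
  {in s, forall e, (e \in E) && (v \in e)} -> \sum_(e <- s) B v e <= 1.
Proof.
move=> Us sE; apply: le_trans (label_sum L v).
rewrite big_uniq //= [leRHS](bigID [pred e | e \in s]) /=.
rewrite -[leLHS]addr0; apply: lerD.
  rewrite le_eqVlt; apply/orP; left; apply/eqP; apply: eq_bigl => e.
  by case es: (e \in s); rewrite ?andbF // (sE e es).
by apply: sumr_ge0 => e /andP[/andP[eE ve] _]; apply/ltW/(label_gt0 L).
Qed.

Lemma label_sum2 v e f : e \in E -> f \in E -> v \in e -> v \in f -> f != e ->
  B v e + B v f <= 1.
Proof.
move=> eE fE ve vf fe; have := @label_sum_seq v [:: e; f].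
rewrite !big_cons big_nil addr0; apply=> [|h]; first by rewrite /= inE eq_sym fe.
by rewrite !inE => /orP[] /eqP->; apply/andP.
Qed.

Lemma label_sum3 v e f h : e \in E -> f \in E -> h \in E ->
  v \in e -> v \in f -> v \in h -> uniq [:: e; f; h] ->
  B v e + B v f + B v h <= 1.
Proof.
move=> eE fE hE ve vf vh U; have := @label_sum_seq v [:: e; f; h] U.
rewrite !big_cons big_nil addr0 addrA; apply=> k.
by rewrite !inE => /or3P[] /eqP->; apply/andP.
Qed.

Lemma label_le1 v e : e \in E -> v \in e -> B v e <= 1.
Proof.
move=> eE ve; have := @label_sum_seq v [:: e] isT.
by rewrite big_cons big_nil addr0; apply=> f; rewrite inE => /eqP->; rewrite eE.
Qed.

Lemma label_prod_seq e (s : seq V) : e \in E -> uniq s -> {subset s <= e} ->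
  alpha <= \prod_(v <- s) B v e.
Proof.
move=> eE Us se; apply: le_trans (label_prod L eE) _.
rewrite big_uniq //= (bigID [pred v | v \in s]) /= -[leRHS]mulr1.
apply: ler_pM.
- by apply: prodr_ge0 => v /andP[ve _]; apply/ltW/(label_gt0 L).
- by apply: prodr_ge0 => v /andP[ve _]; apply/ltW/(label_gt0 L).
- rewrite le_eqVlt; apply/orP; left; apply/eqP; apply: eq_bigl => v.
  by case vs: (v \in s); rewrite ?andbF // (se v vs).
- by apply: prodr_ile1 => v /andP[ve _]; rewrite label_le1 // ltW // (label_gt0 L).
Qed.

Lemma label_ge e v : e \in E -> v \in e -> alpha <= B v e.
Proof.
move=> eE ve; have := @label_prod_seq e [:: v] eE isT.
by rewrite big_cons big_nil mulr1; apply=> u; rewrite inE => /eqP->.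
Qed.

Lemma label_prod2 e v u : e \in E -> v \in e -> u \in e -> u != v ->
  alpha <= B v e * B u e.
Proof.
move=> eE ve ue uv; have := @label_prod_seq e [:: v; u] eE.
rewrite !big_cons big_nil mulr1; apply; first by rewrite /= inE eq_sym uv.
by move=> x; rewrite !inE => /orP[] /eqP->.
Qed.

Lemma label_prod3 e v u x : e \in E -> v \in e -> u \in e -> x \in e ->
  uniq [:: v; u; x] -> alpha <= B v e * B u e * B x e.
Proof.
move=> eE ve ue xe U; have := @label_prod_seq e [:: v; u; x] eE U.
rewrite !big_cons big_nil mulr1 mulrA; apply.
by move=> y; rewrite !inE => /or3P[] /eqP->.
Qed.

Lemma label_prod4 e v u x y : e \in E ->
  v \in e -> u \in e -> x \in e -> y \in e ->
  uniq [:: v; u; x; y] -> alpha <= B v e * B u e * B x e * B y e.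
Proof.
move=> eE ve ue xe ye U; have := @label_prod_seq e [:: v; u; x; y] eE U.
rewrite !big_cons big_nil mulr1 !mulrA; apply.
by move=> z; rewrite !inE => /or4P[] /eqP->.
Qed.

(** Each of the other edges at v claims at least alpha. *)
Lemma label_degree e v : e \in E -> v \in e ->
  B v e + ((degree H v).-1)%:R * alpha <= 1.
Proof.
move=> eE ve; apply: le_trans (label_sum L v).
rewrite (bigD1 e) /=; last by rewrite eE.
rewrite lerD2l.
apply: (@le_trans _ _ (\sum_(f in [set f in E | v \in f] :\ e) alpha)).
  have vE : e \in [set f in E | v \in f] by rewrite inE eE.
  by rewrite sumr_const mulr_natl /degree (cardsD1 e) vE.
rewrite big_mkcond [leRHS]big_mkcond /=; apply: ler_sum => f _.
rewrite !inE; case: (f == e) => //=; rewrite ?andbF // andbT.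
by case: ifP => // /andP[fE vf]; apply: label_ge.
Qed.

(** A label of entry p below the fixed point 1 - g cannot grow along a walk: the
    label of exit is at least alpha / p, and what it leaves to the next
    edge, 1 - alpha / p, is at most p. *)
Lemma nbw_decreasing e0 v e u w p (l := last (e, u) w) :
  nbw H e0 v ((e, u) :: w) -> 0 < p -> p <= 1 - g -> B v e <= p ->
  alpha <= p * B l.2 l.1.
Proof.
rewrite {}/l => + p0 pg; have := golden_eq L => gg'; have /andP[g1 g2] := golden_bounds.
elim: w e0 v e u => [|[f x] w IH] e0 v e u.
  move=> /= /and5P[eE ve _ ue /andP[uv _]] vp.
  apply: le_trans (label_prod2 eE ve ue uv) _.
  by rewrite ler_wpM2r // ltW // (label_gt0 L).
rewrite [nbw _ _ _ _]/= => /and5P[eE ve _ ue /andP[uv N]] vp.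
apply: (IH _ _ _ _ N); move: N => /= /and5P[fE uf fe _ _].
have h1 := label_prod2 eE ve ue uv; have h2 := label_sum2 eE fE ue uf fe.
have h3 : B v e * B u e <= p * B u e by rewrite ler_wpM2r // ltW // (label_gt0 L).
have h4 : 0 <= (1 - g - p) * (g - p) by apply: mulr_ge0; lra.
by rewrite -(ler_pM2l p0); nra.
Qed.

(** The estimate of nbw_decreasing for the reversed walk. *)
Lemma nbw_decreasing_rev e0 v e u w q (l := last (e, u) w) :
  nbw H e0 v ((e, u) :: w) -> 0 < q -> q <= 1 - g -> B l.2 l.1 <= q ->
  alpha <= q * B v e.
Proof.
rewrite {}/l => + q0 qg; have := golden_eq L => gg'; have /andP[g1 g2] := golden_bounds.
elim: w e0 v e u => [|[f x] w IH] e0 v e u.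
  move=> /= /and5P[eE ve _ ue /andP[uv _]] vp.
  apply: le_trans (label_prod2 eE ve ue uv) _.
  by rewrite mulrC ler_wpM2r // ltW // (label_gt0 L).
rewrite [nbw _ _ _ _]/= => /and5P[eE ve _ ue /andP[uv N]] vp.
have h0 := IH _ _ _ _ N vp; move: N => /= /and5P[fE uf fe _ _].
have h1 := label_prod2 eE ve ue uv; have h2 := label_sum2 eE fE ue uf fe.
have h4 : 0 <= (1 - g - q) * (g - q) by apply: mulr_ge0; lra.
have h5 : B u e <= q by rewrite -(ler_pM2l q0); nra.
apply: le_trans h1 _; rewrite mulrC ler_wpM2r //.
by apply/ltW/(label_gt0 L).
Qed.

(** The edge of arrival takes more than 1 - g, so the first and last edges of
    the loop share less than g. But these two labels have product at least
    alpha: the smaller the loop starts, the larger it ends. This is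
    impossible since 4 * alpha > g * g. *)
Lemma no_loop_at_vertex e0 v e u w (l := last (e, u) w) :
  e0 \in E -> v \in e0 -> 1 - g < B v e0 -> nbw H e0 v ((e, u) :: w) ->
  l.2 = v -> l.1 != e0 -> l.1 != e -> False.
Proof.
move=> e0E ve0 lb N lv le0 le.
have := golden_eq L => gg'; have /andP[g1 g2] := golden_bounds.
have /andP[lE] := nbw_last N; rewrite -/l lv => vl.
have [eE ve ee0] : [/\ e \in E, v \in e & e != e0].
  by move: N => /= /and5P[].
have h3 : B v e0 + B v e + B v l.1 <= 1.
  by apply: label_sum3 => //; rewrite /= !inE !negb_or -!(eq_sym e0) in ee0 le0 *;
     rewrite ee0 le0 eq_sym le.
have p0 := label_gt0 L eE ve; have q0 := label_gt0 L lE vl; have qa := label_ge lE vl.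
have [pg|pg] := leP (B v e) (1 - g); last by lra.
have := nbw_decreasing N p0 pg (lexx _); rewrite -/l lv => h4.
have h5 : (B v e + B v l.1) ^+ 2 <= g ^+ 2.
  by rewrite ler_sqr ?nnegrE; lra.
have h6 : 0 <= (B v e - B v l.1) ^+ 2 by apply: sqr_ge0.
by move: h5 h6; rewrite !expr2 !(mulrDl, mulrDr, mulrBl, mulrBr) gg'; nra.
Qed.

(** One of the labels at a and b is at least g. Going round the loop from that
    side, one starts with at most 1 - g and ends with at least g, so that
    the label at the other side is at most 1 - g, and so is the product. *)
Lemma no_loop_at_edge e a b f u w (l := last (f, u) w) :
  e \in E -> a \in e -> b \in e -> 1 - g < B a e * B b e ->
  nbw H e a ((f, u) :: w) -> l.2 = b -> l.1 != e -> False.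
Proof.
move=> eE ae be lb N lv le.
have := golden_eq L => gg'; have /andP[g1 g2] := golden_bounds.
have /andP[lE] := nbw_last N; rewrite -/l lv => bl.
have [fE af fe] : [/\ f \in E, a \in f & f != e].
  by move: N => /= /and5P[].
have hp := label_sum2 eE fE ae af fe; have hq := label_sum2 eE lE be bl le.
have p0 := label_gt0 L fE af; have q0 := label_gt0 L lE bl.
have x0 := label_gt0 L eE ae; have y0 := label_gt0 L eE be.
have [xg|xg] := leP g (B a e).
  have pg : B a f <= 1 - g by lra.
  have := nbw_decreasing N p0 pg (lexx _); rewrite -/l lv => h4.
  have h5 : B a f * B b l.1 <= (1 - g) * B b l.1 by rewrite ler_wpM2r // ltW.
  have h6 : B a e * B b e <= 1 * B b e by apply: ler_wpM2r; [exact: ltW|exact: label_le1].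
  have h7 : g <= B b l.1 by rewrite -(@ler_pM2l _ (1 - g)); [nra|lra].
  lra.
have yg : g <= B b e.
  rewrite leNgt; apply/negP => yg.
  have : B a e * B b e <= g * g by apply: ler_pM; rewrite ltW.
  by lra.
have qg : B b l.1 <= 1 - g by lra.
have := nbw_decreasing_rev N q0 qg; rewrite -/l lv => /(_ (lexx _)) h4.
have h5 : B b l.1 * B a f <= (1 - g) * B a f by rewrite ler_wpM2r // ltW.
have h6 : B b e * B a e <= 1 * B a e by apply: ler_wpM2r; [exact: ltW|exact: label_le1].
have h7 : g <= B a f by rewrite -(@ler_pM2l _ (1 - g)); [nra|lra].
by move: h6; rewrite mulrC; lra.
Qed.

(** If e0 takes more than 1 - g at v, the next edge is entered with less than g
    and left with more than alpha / g = 1 - g. *)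
Lemma nbw_label e0 v w : e0 \in E -> v \in e0 -> 1 - g < B v e0 ->
  nbw H e0 v w ->
  [/\ last e0 (unzip1 w) \in E, last v (unzip2 w) \in last e0 (unzip1 w) &
   1 - g < B (last v (unzip2 w)) (last e0 (unzip1 w))].
Proof.
elim: w e0 v => [|[e u] w IH] e0 v //= e0E ve0 lb.
move=> /and5P[eE ve ee0 ue /andP[uv N]]; apply: IH => //.
have h1 := label_prod2 eE ve ue uv; have h2 := label_sum2 e0E eE ve0 ve ee0.
have h3 := label_gt0 L eE ue.
have := golden_eq L => gg'; have /andP[g1 g2] := golden_bounds.
have h4 : B v e * B u e < g * B u e by rewrite ltr_pM2r //; lra.
by rewrite -(@ltr_pM2l _ g) //; nra.
Qed.

(** The smallest label that a hanging path with n edges can have at the vertex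
    from which it hangs. It increases to 1 - g, a fixed point of the
    recursion. *)
Fixpoint path_label n : R :=
  if n is m.+1 then (2 * g - 1) / (1 - path_label m) else 0.

Lemma path_label_bounds n : 0 <= path_label n <= 1 - g.
Proof.
have /andP[g1 g2] := golden_bounds; have gg' := golden_eq L.
elim: n => [|n /andP[h1 h2]] /=; first by rewrite lexx; lra.
rewrite divr_ge0; [|lra|lra]; rewrite ler_pdivrMr; last by lra.
have : (1 - g) * g <= (1 - g) * (1 - path_label n) by apply: ler_wpM2l; lra.
by rewrite mulrBl gg'; lra.
Qed.

Lemma path_label_step c d n k : (forall m, (k <= m)%N -> c <= path_label m) ->
  d * (1 - c) <= alpha -> 0 <= d -> c < 1 -> (k < n)%N -> d <= path_label n.
Proof.
move=> IH h d0 c1; case: n => // n; rewrite ltnS => /IH h1 /=.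
have /andP[h2 h3] := path_label_bounds n; have /andP[g1 g2] := golden_bounds.
rewrite ler_pdivlMr; last by lra.
by apply: le_trans h; apply: ler_wpM2l; lra.
Qed.

(** The bounds are the exact values of path_label 1, ..., path_label 6, which
    are linear in g because g * g = 1 - g. *)
Lemma path_label_lower n :
  [/\ (1 <= n)%N -> 2 * g - 1 <= path_label n,
      (2 <= n)%N -> g / 2 <= path_label n,
      (3 <= n)%N -> (6 * g - 2) / 5 <= path_label n,
      (4 <= n)%N -> (8 * g - 1) / 11 <= path_label n &
      [/\ (5 <= n)%N -> (4 * g - 1) / 4 <= path_label n &
      (6 <= n)%N -> (24 * g - 4) / 29 <= path_label n]].
Proof.
have /andP[g1 g2] := golden_bounds; have gg' := golden_eq L.
have b0 m : (0 <= m)%N -> 0 <= path_label m.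
  by case/andP: (path_label_bounds m).
have b1 m : (1 <= m)%N -> 2 * g - 1 <= path_label m.
  by apply: (path_label_step b0); lra.
have b2 m : (2 <= m)%N -> g / 2 <= path_label m.
  by apply: (path_label_step b1); nra.
have b3 m : (3 <= m)%N -> (6 * g - 2) / 5 <= path_label m.
  by apply: (path_label_step b2); nra.
have b4 m : (4 <= m)%N -> (8 * g - 1) / 11 <= path_label m.
  by apply: (path_label_step b3); nra.
have b5 m : (5 <= m)%N -> (4 * g - 1) / 4 <= path_label m.
  by apply: (path_label_step b4); nra.
have b6 m : (6 <= m)%N -> (24 * g - 4) / 29 <= path_label m.
  by apply: (path_label_step b5); nra.
by split; [apply: b1|apply: b2|apply: b3|apply: b4|split; [apply: b5|apply: b6]].
Qed.

Local Notation room n := (1 - path_label n).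

Lemma room_bounds n :
  [/\ 0 <= room n,
      (1 <= n)%N -> room n <= 13 / 17, (2 <= n)%N -> room n <= 9 / 13,
      (3 <= n)%N -> room n <= 27 / 41 &
      [/\ (4 <= n)%N -> room n <= 34 / 53,
      (5 <= n)%N -> room n <= 31 / 49 & (6 <= n)%N -> room n <= 42 / 67]].
Proof.
have /andP[g1 g2] := golden_bounds; have /andP[p1 p2] := path_label_bounds n.
have [h1 h2 h3 h4 [h5 h6]] := path_label_lower n.
split; first by lra.
- by move/h1; lra.
- by move/h2; lra.
- by move/h3; lra.
- by split; [move/h4; lra|move/h5; lra|move/h6; lra].
Qed.

Lemma prod4_le (x y z t x' y' z' t' : R) :
  0 <= x -> 0 <= y -> 0 <= z -> 0 <= t -> x <= x' -> y <= y' -> z <= z' ->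
  t <= t' -> x * y * z * t <= x' * y' * z' * t'.
Proof. by move=> *; rewrite !ler_pM ?mulr_ge0. Qed.

(** The length vectors to be excluded dominate (1, 2, 2) or (1, 1, 4). *)
Lemma quipu_lengths i j k : (0 < i)%N -> (i <= j <= k)%N ->
  2 * g - 1 <= g * room i * room j * room k ->
  [/\ i = 1%N, j = 1%N & (0 < k <= 3)%N].
Proof.
move=> i0 /andP[ij jk] h.
have /andP[g1 g2] := golden_bounds; have g0 := ltW (golden_gt0 L).
have g6 : g <= 34 / 55 by lra.
have [a0 a1 a2 a3 [a4 a5 a6]] := room_bounds i.
have [b0 b1 b2 b3 [b4 b5 b6]] := room_bounds j.
have [c0 c1 c2 c3 [c4 c5 c6]] := room_bounds k.
have j1 : (j <= 1)%N.
  rewrite leqNgt; apply/negP => j2.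
  have := prod4_le g0 a0 b0 c0 g6 (a1 i0) (b2 j2) (c2 (leq_trans j2 jk)).
  by lra.
have k3 : (k <= 3)%N.
  rewrite leqNgt; apply/negP => k4.
  have := prod4_le g0 a0 b0 c0 g6 (a1 i0) (b1 (leq_trans i0 ij)) (c4 k4).
  by lra.
have -> : i = 1%N by apply/eqP; rewrite eqn_leq i0 (leq_trans ij).
have -> : j = 1%N by apply/eqP; rewrite eqn_leq j1 (leq_trans i0).
by split=> //; rewrite k3 andbT (leq_trans i0) // (leq_trans ij).
Qed.

(** The length vectors to be excluded dominate one of (2, 2, 2, 2), (1, 3, 3,
    3), (1, 2, 3, 3), (1, 2, 2, 4), (1, 1, 5, 5) and (1, 1, 4, 6). *)
Lemma dagger_lengths i j k l : (0 < i)%N -> [&& i <= j, j <= k & k <= l]%N ->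
  2 * g - 1 <= room i * room j * room k * room l ->
  (i, j, k, l) \in [:: (1, 2, 2, 2); (1, 2, 2, 3); (1, 1, 4, 4); (1, 1, 4, 5)]%N
  \/ [/\ i = 1, j = 1 & 1 <= k <= 3]%N.
Proof.
move=> i0 /and3P[ij jk kl] h.
have j0 := leq_trans i0 ij; have k0 := leq_trans j0 jk.
have /andP[g1 g2] := golden_bounds.
have [a0 a1 a2 a3 [a4 a5 a6]] := room_bounds i.
have [b0 b1 b2 b3 [b4 b5 b6]] := room_bounds j.
have [c0 c1 c2 c3 [c4 c5 c6]] := room_bounds k.
have [d0 d1 d2 d3 [d4 d5 d6]] := room_bounds l.
have i1 : i = 1%N.
  apply/eqP; rewrite eqn_leq i0 andbT leqNgt; apply/negP => i2.
  have j2 := leq_trans i2 ij; have k2 := leq_trans j2 jk.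
  have l2 := leq_trans k2 kl.
  by have := prod4_le a0 b0 c0 d0 (a2 i2) (b2 j2) (c2 k2) (d2 l2); lra.
have j3 : (j < 3)%N.
  rewrite ltnNge; apply/negP => j3; have k3 := leq_trans j3 jk.
  have l3 := leq_trans k3 kl.
  by have := prod4_le a0 b0 c0 d0 (a1 i0) (b3 j3) (c3 k3) (d3 l3); lra.
have [j2|j2] := leqP 2 j.
  have k2 := leq_trans j2 jk.
  have k3 : (k < 3)%N.
    rewrite ltnNge; apply/negP => k3; have l3 := leq_trans k3 kl.
    by have := prod4_le a0 b0 c0 d0 (a1 i0) (b2 j2) (c3 k3) (d3 l3); lra.
  have l4 : (l < 4)%N.
    rewrite ltnNge; apply/negP => l4.
    by have := prod4_le a0 b0 c0 d0 (a1 i0) (b2 j2) (c2 k2) (d4 l4); lra.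
  have ej : j = 2%N by apply/eqP; rewrite eqn_leq j2 andbT.
  have ek : k = 2%N by apply/eqP; rewrite eqn_leq k2 andbT.
  left; move: kl l4; rewrite i1 ej ek.
  by case: l {h d0 d1 d2 d3 d4 d5 d6} => [|[|[|[|]]]].
have ej : j = 1%N by apply/eqP; rewrite eqn_leq j0 andbT.
have [k4|k4] := leqP 4 k; last by right; rewrite k0.
have k5 : (k < 5)%N.
  rewrite ltnNge; apply/negP => k5; have l5 := leq_trans k5 kl.
  by have := prod4_le a0 b0 c0 d0 (a1 i0) (b1 j0) (c5 k5) (d5 l5); lra.
have l6 : (l < 6)%N.
  rewrite ltnNge; apply/negP => l6.
  by have := prod4_le a0 b0 c0 d0 (a1 i0) (b1 j0) (c4 k4) (d6 l6); lra.
have ek : k = 4%N by apply/eqP; rewrite eqn_leq k4 andbT.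
left; move: kl l6; rewrite i1 ej ek.
by case: l {h d0 d1 d2 d3 d4 d5 d6} => [|[|[|[|[|[|]]]]]].
Qed.
End Inequalities.

(** * Everything grows from a full edge *)

Section Rooted.
Variable F : {set V}.
Hypotheses (FE : F \in E) (F_deg : forall v, v \in F -> 1 < degree H v).

Section Tree.
Local Open Scope ring_scope.

Lemma root_le v : v \in F -> B v F <= 2 - 2 * g.
Proof.
move=> vF; have := label_degree FE vF; have := F_deg vF.
case: degree => [|[|d]] // _ /=; have /andP[g1 g2] := golden_bounds.
rewrite -addn1 natrD mulrDl mul1r => h.
have : 0 <= d%:R * alpha by apply: mulr_ge0; [apply: ler0n|lra].
by lra.
Qed.

(** The three other labels of F are at most 2 - 2 * g, which leaves at least
    alpha / (2 - 2 * g) ^+ 3 to v. The bound 3 - 4 * g is 1 - 2 * alpha: two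
    edges besides F no longer fit at v. *)
Lemma root_gt v : v \in F -> 3 - 4 * g < B v F.
Proof.
move=> vF; have [x [y [z [[xF yF zF] U Fv]]]] := edge_enum FE vF.
have := golden_eq L => gg'; have /andP[g1 g2] := golden_bounds.
have := label_prod4 FE vF xF yF zF U.
have v0 := label_gt0 L FE vF.
have h : B x F * B y F * B z F <= (2 - 2 * g) * (2 - 2 * g) * (2 - 2 * g).
  by rewrite !ler_pM ?mulr_ge0 ?root_le ?ltW ?(label_gt0 L).
have -> : B v F * B x F * B y F * B z F = B v F * (B x F * B y F * B z F).
  by rewrite !mulrA.
rewrite ltNge => h1; apply/negP => h2.
have : B v F * (B x F * B y F * B z F) <=
    (3 - 4 * g) * ((2 - 2 * g) * (2 - 2 * g) * (2 - 2 * g)).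
  by apply: ler_pM => //; rewrite ?mulr_ge0 ?ltW ?(label_gt0 L).
have -> : (3 - 4 * g) * ((2 - 2 * g) * (2 - 2 * g) * (2 - 2 * g)) = 376 - 608 * g.
  apply/eqP; rewrite -subr_eq0.
  have -> : (3 - 4 * g) * ((2 - 2 * g) * (2 - 2 * g) * (2 - 2 * g)) -
      (376 - 608 * g) = (g * g - (1 - g)) * (32 * (g * g) - 152 * g + 352).
    by ring.
  by rewrite gg' subrr mul0r.
by lra.
Qed.

Lemma root_degree v : v \in F -> degree H v = 2%N.
Proof.
move=> vF; apply/eqP; rewrite eqn_leq (F_deg vF) andbT leqNgt; apply/negP => d3.
have := label_degree FE vF; have := root_gt vF.
case: degree d3 => [|[|[|d]]] // _; have /andP[g1 g2] := golden_bounds.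
rewrite -[_.-1]addn2 natrD mulrDl => h1 h2.
have : 0 <= d%:R * alpha by apply: mulr_ge0; [apply: ler0n|lra].
by lra.
Qed.

Lemma root_far v : v \in F -> 1 - g < B v F.
Proof.
move=> vF; have := root_gt vF.
by have /andP[g1 g2] := golden_bounds; lra.
Qed.

Lemma root_pair v u : v \in F -> u \in F -> u != v -> 1 - g < B v F * B u F.
Proof.
move=> vF uF uv; have [x [y [z [[xF yF zF] U Fv]]]] := edge_enum FE vF.
have gg' := golden_eq L; have /andP[g1 g2] := golden_bounds.
have B0 a : a \in F -> 0 <= B a F by move=> aF; rewrite ltW // (label_gt0 L).
have key a b c : a \in F -> b \in F -> c \in F -> uniq [:: v; a; b; c] ->
    1 - g < B v F * B a F.
  move=> aF bF cF Uabc; have := label_prod4 FE vF aF bF cF Uabc.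
  rewrite -mulrA ltNge => h1; apply/negP => h2.
  have h3 : B b F * B c F <= (2 - 2 * g) * (2 - 2 * g).
    by apply: ler_pM; rewrite ?B0 // (root_le).
  have : B v F * B a F * (B b F * B c F) <=
      (1 - g) * ((2 - 2 * g) * (2 - 2 * g)).
    by apply: ler_pM; rewrite // mulr_ge0 ?B0.
  rewrite golden_product.
  by lra.
move: U uF; rewrite Fv /= !inE !negb_or (negbTE uv) /= => /and4P[/and3P[a b c] /andP[d k] h _].
case/or3P=> /eqP ->.
- by apply: (key _ y z) => //; rewrite /= !inE !negb_or a b c d k h.
- by apply: (key _ x z) => //; rewrite /= !inE !negb_or a b c (eq_sym y) d k h.
- by apply: (key _ x y) => //; rewrite /= !inE !negb_or a b c d !(eq_sym z) k h.
Qed.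

(** Consider the first repetition. A vertex visited twice bounds a loop excluded
    by no_loop_at_vertex. An edge visited twice, or F itself, is left by a
    vertex a and met again at a vertex b; since its other labels multiply to
    less than g, the labels at a and b multiply to more than 1 - g, and
    no_loop_at_edge applies. *)
Lemma nbw_root_uniq v0 w : v0 \in F -> nbw H F v0 w ->
  uniq (F :: unzip1 w) && uniq (v0 :: unzip2 w).
Proof.
move=> v0F; elim/last_ind: w => [|w [e u] IH] //.
rewrite -cats1 nbw_cat => /andP[N]; case/andP: (IH N) => U1 U2 {IH}.
move=> /= /and5P[eE le e_ne ue /andP[u_ne _]].
have /andP[g1 g2] := golden_bounds; have gg' := golden_eq L.
have eF : e != F.
  apply/eqP => eF; case: w => [|[f x] w] in N U1 U2 le e_ne u_ne *.
    by rewrite eF eqxx in e_ne.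
  rewrite last_unzip2 eF in le.
  have b_w : (last (f, x) w).2 \in unzip2 ((f, x) :: w).
    by apply: map_f; apply: mem_last.
  apply: (@no_loop_at_edge F v0 (last (f, x) w).2 f x w) => //.
    apply: root_pair => //; apply: contraTneq U2 => /= <-.
    by rewrite b_w.
  by move: e_ne; rewrite eF last_unzip1 eq_sym.
have e_w : e \notin unzip1 w.
  apply/negP => /mapP[[e' a] /= + ee']; rewrite -{}ee' {e'} => eaw.
  case/splitPr: eaw N U1 U2 le e_ne u_ne => w1 [|[f x] w2].
    by rewrite unzip1_cat last_cat /= eqxx.
  rewrite nbw_cat nbw_cons => /andP[N1 /and5P[_ ve e_ne ae /andP[av N2]]].
  rewrite unzip1_cat unzip2_cat -(cat_cons v0) [uniq (_ ++ unzip2 _)]cat_uniq => _ /and3P[_ U2 U3] + + _.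
  rewrite !last_cat last_unzip1 last_unzip2.
  rewrite ![last (e, a) _]/= => be be_ne.
  set v := last v0 (unzip2 w1) in ve av; set b := (last _ _).2 in be.
  have bw : b \in unzip2 ((f, x) :: w2) by apply: map_f; apply: mem_last.
  have vw : v \in v0 :: unzip2 w1 by apply: mem_last.
  have ab : b != a.
    by apply: contraTneq U3 => <-; rewrite /= bw.
  have vb : b != v.
    apply: contraNneq U2 => bv; apply/hasP; exists b; last by rewrite bv.
    by rewrite inE bw orbT.
  have [h1 h2 vl] := nbw_label FE v0F (root_far v0F) N1.
  rewrite -/v in h2 vl; have h3 := label_sum2 h1 eE h2 ve e_ne.
  apply: (@no_loop_at_edge e a b f x w2) => //; last first.
    by rewrite eq_sym.
  have := label_prod3 eE ve ae be; rewrite /= !inE negb_or ![v == _]eq_sym av vb.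
  rewrite eq_sym ab -mulrA => /(_ isT) h4; rewrite ltNge; apply/negP => h5.
  have h6 : B v e * (B a e * B b e) <= B v e * (1 - g).
    by apply: ler_wpM2l => //; apply/ltW/(label_gt0 L).
  have : B v e * (1 - g) < g * (1 - g) by rewrite ltr_pM2r; lra.
  by rewrite (mulrBr g) gg'; lra.
have u_v0 : u != v0.
  apply/eqP => uv; case: w => [|[f x] w] in N U1 U2 le e_ne u_ne e_w *.
    by rewrite uv eqxx in u_ne.
  apply: (@no_loop_at_vertex F v0 f x (rcons w (e, u))) => //.
  - exact: root_far.
  - rewrite -rcons_cons -cats1 nbw_cat N /= eE le e_ne ue.
    by move: u_ne => /= ->.
  - by rewrite last_rcons.
  - by rewrite last_rcons.
  - by rewrite last_rcons; move: e_w; rewrite /= inE negb_or => /andP[].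
have u_w : u \notin unzip2 w.
  apply/negP => /mapP[[f a] /= + ua]; rewrite -{}ua {a} => faw.
  case/splitPr: faw N U1 U2 le e_ne u_ne e_w => w1 [|[h x] w2].
    by rewrite unzip2_cat last_cat /= eqxx.
  rewrite -cat_rcons nbw_cat => /andP[N1 N2] _ _.
  have [h1 h2 h3] := nbw_label FE v0F (root_far v0F) N1.
  rewrite /unzip1 /unzip2 !map_rcons !last_rcons in h1 h2 h3 N2.
  rewrite unzip1_cat unzip2_cat !last_cat mem_cat !negb_or.
  rewrite last_unzip1 last_unzip2.
  move=> /= le e_ne u_ne.
  rewrite /unzip1 map_rcons mem_rcons inE negb_or => /and3P[/andP[ef _] eh _].
  apply: (@no_loop_at_vertex f u h x (rcons w2 (e, u))) => //;
    rewrite ?last_rcons //.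
  rewrite -rcons_cons -cats1 nbw_cat N2 last_unzip1.
  by rewrite last_unzip2 /= eE le e_ne ue u_ne.
have [-> ->] : unzip1 (w ++ [:: (e, u)]) = rcons (unzip1 w) e /\
    unzip2 (w ++ [:: (e, u)]) = rcons (unzip2 w) u.
  by rewrite /unzip1 /unzip2 !map_cat /= !cats1.
rewrite !mem_rcons !inE !negb_or !rcons_uniq e_w u_w (eq_sym F) (eq_sym v0).
by move: U1 U2; rewrite !cons_uniq => /andP[-> ->] /andP[-> ->]; rewrite eF u_v0.
Qed.

Definition arrives e v := exists v0 w,
  [/\ v0 \in F, nbw H F v0 w, last F (unzip1 w) = e & last v0 (unzip2 w) = v].

Lemma arrives_root v : v \in F -> arrives F v.
Proof. by move=> vF; exists v, [::]. Qed.

Lemma arrives_nbw e v w : arrives e v -> nbw H e v w ->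
  arrives (last e (unzip1 w)) (last v (unzip2 w)).
Proof.
case=> v0 [w0 [v0F N0 <- <-]] N; exists v0, (w0 ++ w).
by rewrite unzip1_cat unzip2_cat !last_cat nbw_cat N0 N.
Qed.

Lemma arrives_step e v f u : arrives e v -> f \in E -> v \in f -> f != e ->
  u \in f -> u != v -> arrives f u.
Proof.
move=> A fE vf fe uf uv; apply: (@arrives_nbw e v [:: (f, u)] A).
by rewrite /= fE vf fe uf uv.
Qed.

Lemma arrivesP e v : arrives e v -> [/\ e \in E, v \in e & 1 - g < B v e].
Proof.
case=> v0 [w [v0F N <- <-]].
by have [] := nbw_label FE v0F (root_far v0F) N.
Qed.

Lemma arrives_uniq e v w : arrives e v -> nbw H e v w ->
  uniq (e :: unzip1 w) && uniq (v :: unzip2 w).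
Proof.
case=> v0 [w0 [v0F N0 <- <-]] N.
have := @nbw_root_uniq v0 (w0 ++ w) v0F; rewrite nbw_cat N0 N => /(_ isT).
rewrite unzip1_cat unzip2_cat -!cat_cons.
rewrite (lastI F) (lastI v0) !cat_rcons !cat_uniq.
by case/andP=> /and3P[_ _ ->] /and3P[_ _ ->].
Qed.

Lemma arrives_all v : connected H -> exists e, arrives e v.
Proof.
have /card_gt0P[v0 v0F] : (0 < #|F|)%N by rewrite (uniform FE).
move=> /(_ v0 v)[w [/and3P[wk U2 U1] <-]].
have [/mapP[[f a] /= + fF]|Fw] := boolP (F \in unzip1 w); last first.
  exists (last F (unzip1 w)); exists v0, w; split=> //.
  apply: walk_nbw => //; case: (w) Fw => [|p w'] //=.
  by rewrite inE negb_or => /andP[Fp _]; apply: contraNneq Fp => -[->].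
rewrite -{}fF => /splitPr faw; case: faw wk U2 U1 => w1 w2.
rewrite walk_cat unzip1_cat unzip2_cat last_cat -cat_cons !cat_uniq.
case/andP=> _ /= /and4P[_ _ aF wk] /and3P[_ _ U2] /and3P[_ _ /andP[Fw U1]].
exists (last F (unzip1 w2)), a, w2; split=> //; apply: walk_nbw => //.
case: (w2) Fw => [|p w'] //=; rewrite inE negb_or => /andP[Fp _].
by apply: contraNneq Fp => -[->].
Qed.

(** A cycle is reached from F at some vertex v. In one of its two directions it
    does not start with the edge of arrival, and then running round it
    revisits v, against nbw_root_uniq. *)
Lemma rooted_acyclic : connected H -> acyclic H.
Proof.
move=> conn v.
suff key w e0 : arrives e0 v -> walk_cycle H v w ->
    ohead (unzip1 w) != Some e0 -> False.
  move=> w; apply/negP => C; have [e0 A] := arrives_all v conn.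
  have [h|h] := boolP (ohead (unzip1 w) == Some e0); last exact: key A C h.
  apply: (key _ _ A (cycle_rev C)); rewrite rev_walk_edges.
  case/and5P: C h => _ _ _; case/lastP: w => [|w q] //; case: w => [|p w] //.
  rewrite /unzip1 map_rcons rev_rcons rcons_uniq /= inE negb_or.
  by case/andP=> /andP[qp _] _ _ /eqP[<-]; apply: contra qp => /eqP[->].
move=> A C h; case/and5P: C => wk /eqP lv U2 U1 sz.
have N : nbw H e0 v w.
  case/lastP: w => [|w [e u]] // in wk lv U2 U1 sz h *.
  case/lastP: w => [|w p] // in wk lv U2 U1 sz h *.
  move: lv U2 U1 wk; rewrite -(cats1 _ (e, u)) walk_cat nbw_cat /=.
  rewrite !unzip1_cat !unzip2_cat last_cat /= => -> /=; rewrite !cats1.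
  rewrite /unzip1 /unzip2 !map_rcons !last_rcons.
  rewrite !rcons_uniq !mem_rcons !inE !negb_or => /andP[/andP[vp vw] U2].
  case/andP=> /andP[ep ew] U1 /and5P[wk -> -> -> _].
  rewrite vp ep !andbT.
  apply: walk_nbw => //; rewrite /unzip1 /unzip2 ?map_rcons.
  - by rewrite cons_uniq mem_rcons inE negb_or vp vw rcons_uniq.
  - by rewrite rcons_uniq.
  - by case: (w) h.
have /andP[_ /=] := arrives_uniq A N.
case: w lv sz {wk U2 U1 h N} => [|p w] //; rewrite last_unzip2 => <- _.
by rewrite map_f ?mem_last.
Qed.
End Tree.

Hypothesis conn : connected H.
Let Hac : acyclic H := rooted_acyclic conn.

Section Branching.
Local Open Scope ring_scope.

(** Induction from the leaves towards F: walks issued from F have distinct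
    vertices, hence bounded length. *)
Lemma arrives_ind (P : {set V} -> V -> Prop) :
  (forall e v, arrives e v ->
     (forall f u, f \in E -> v \in f -> f != e -> u \in f -> u != v -> P f u) ->
     P e v) ->
  forall e v, arrives e v -> P e v.
Proof.
move=> IP e v [v0 [w [v0F N <- <-]]].
elim: {w}(#|V| - size w)%N {-2}w (leqnn (#|V| - size w)%N) N => [|n IH] w; last move=> sz N.
  rewrite leqn0 subn_eq0 leqNgt => + N => /negP[].
  have /andP[_ /card_uniqP] := nbw_root_uniq v0F N.
  rewrite /= size_map => <-.
  exact: max_card.
apply: IP; first by exists v0, w.
move=> f u fE vf fe uf uv.
have := IH (rcons w (f, u)).
rewrite /unzip1 /unzip2 !map_rcons !last_rcons size_rcons; apply.
  by rewrite leq_subLR; move: sz; rewrite leq_subLR addSnnS.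
by rewrite -cats1 nbw_cat N /= fE vf fe uf uv.
Qed.

Lemma degree_le3 v : (degree H v <= 3)%N.
Proof.
have [e A] := arrives_all v conn.
have [eE ve h] := arrivesP A; rewrite leqNgt; apply/negP => d4.
have := label_degree eE ve; case: degree d4 => [|[|[|[|d]]]] // _.
rewrite -[_.-1]addn3 natrD mulrDl => h2; have /andP[g1 g2] := golden_bounds.
have : 0 <= d%:R * alpha by apply: mulr_ge0; [apply: ler0n|lra].
by lra.
Qed.

Lemma near_label e0 v e : arrives e0 v -> e \in E -> v \in e -> e != e0 ->
  B v e < g.
Proof.
move=> A eE ve ee0; have [e0E ve0 h] := arrivesP A.
by have := label_sum2 e0E eE ve0 ve ee0; lra.
Qed.

Lemma label_degree2 e v : e \in E -> v \in e -> (1 < degree H v)%N ->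
  B v e <= 2 - 2 * g.
Proof.
move=> eE ve; have := label_degree eE ve; case: degree => [|[|d]] // h _.
move: h; rewrite -[_.-1]addn1 natrD mulrDl; have /andP[g1 g2] := golden_bounds.
have : 0 <= d%:R * alpha by apply: mulr_ge0; [apply: ler0n|lra].
by lra.
Qed.

Lemma label_degree3 e v : e \in E -> v \in e -> degree H v = 3%N ->
  B v e <= 3 - 4 * g.
Proof.
move=> eE ve d3; have := label_degree eE ve; rewrite d3 /=.
by lra.
Qed.

Lemma degree_gt1 e f v : e \in E -> f \in E -> v \in e -> v \in f -> f != e ->
  (1 < degree H v)%N.
Proof.
move=> eE fE ve vf fe; rewrite /degree (cardsD1 e) (cardsD1 f) !inE.
by rewrite eE fE ve vf fe.
Qed.

Lemma degree_gt2 e f h v : e \in E -> f \in E -> h \in E ->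
  v \in e -> v \in f -> v \in h -> uniq [:: e; f; h] -> (2 < degree H v)%N.
Proof.
move=> eE fE hE ve vf vh; rewrite /= !inE negb_or => /and3P[/andP[ef eh] fh _].
rewrite /degree (cardsD1 e) (cardsD1 f) (cardsD1 h) !inE.
by rewrite eE fE hE ve vf vh ![_ == e]eq_sym ef eh eq_sym fh.
Qed.

Lemma branching_degree k e v : branching_edge H k e -> v \in e ->
  (degree H v <= 2)%N.
Proof.
case/and3P=> _ /forallP/(_ v)/implyP + _ ve => /(_ ve).
have := degree_le3 v; rewrite /branching_vertex.
by case: degree => [|[|[|[|]]]].
Qed.

Lemma branching_edge_sum k e v x y z : branching_edge H k e -> v \in e ->
  uniq [:: v; x; y; z] -> e =i [:: v; x; y; z] ->
  ((degree H v).-1 + (degree H x).-1 + (degree H y).-1 + (degree H z).-1)%N = k.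
Proof.
case/and3P=> eE _ /eqP<- ve U ee; rewrite (card_incident Hac eE).
rewrite (eq_bigl (mem [:: v; x; y; z])) //.
by rewrite -big_uniq //= !big_cons big_nil addn0 !addnA.
Qed.

Lemma label_of_two_branches e v x y : e \in E -> v \in e -> x \in e -> y \in e ->
  uniq [:: v; x; y] -> B x e <= 2 - 2 * g -> B y e <= 2 - 2 * g ->
  1 - g < B v e.
Proof.
move=> eE ve xe ye U hx hy; have := label_prod3 eE ve xe ye U.
have /andP[g1 g2] := golden_bounds; have gg' := golden_eq L.
rewrite -mulrA ltNge => h; apply/negP => hv.
have h3 : B x e * B y e <= (2 - 2 * g) * (2 - 2 * g).
  by apply: ler_pM; rewrite // ltW // (label_gt0 L).
have : B v e * (B x e * B y e) <= (1 - g) * ((2 - 2 * g) * (2 - 2 * g)).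
  by apply: ler_pM; rewrite // ?mulr_ge0 // ltW // (label_gt0 L).
rewrite golden_product.
by lra.
Qed.

(** The transport t |-> alpha / (1 - t) fixes 1 - g, so the lower bound survives
    along a path. It holds at the branching item: a vertex of degree three
    leaves at most 1 - 2 * alpha to the edge before it, and a branching edge
    has two more vertices with at most 1 - alpha. *)
Lemma beyond_label v e x : beyond H v e x -> branching_item H x ->
  e \in E -> v \in e -> 1 - g <= B v e.
Proof.
have /andP[g1 g2] := golden_bounds; have gg' := golden_eq L.
elim=> {v e x} [v e|v e u ue uv|v e u f x ue uv fE uf fe _ IH] br eE ve.
- have {br} [k k3 br] : exists2 k, (2 < k)%N & branching_edge H k e.
    by case/orP: br => br; [exists 3|exists 4].
  have [x [y [z [[xe ye ze] U ee]]]] := edge_enum eE ve.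
  have := branching_edge_sum br ve U ee.
  have dv := branching_degree br ve; have dx := branching_degree br xe.
  have dy := branching_degree br ye; have dz := branching_degree br ze.
  move=> sk; rewrite -sk {sk} in k3.
  have : [|| (1 < degree H x) && (1 < degree H y),
             (1 < degree H x) && (1 < degree H z) |
             (1 < degree H y) && (1 < degree H z)]%N.
    by move: k3 dv dx dy dz; do 4! case: degree => [|[|[|?]]] //.
  move: U; rewrite /= !inE !negb_or => /and4P[/and3P[vx vy vz] /andP[xy xz] yz _].
  by case/or3P=> /andP[h1 h2]; apply/ltW;
    [apply: (@label_of_two_branches e v x y)|apply: (@label_of_two_branches e v x z)|
     apply: (@label_of_two_branches e v y z)];
    rewrite ?label_degree2 //= !inE !negb_or ?vx ?vy ?vz ?xy ?xz ?yz.
- have d3 : degree H u = 3%N by move/eqP: br.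
  have h1 := label_prod2 eE ve ue uv; have h2 := label_degree3 eE ue d3.
  rewrite leNgt; apply/negP => h3.
  have h4 : B v e * B u e <= (1 - g) * (3 - 4 * g).
    by apply: ler_pM; rewrite // ltW // (label_gt0 L).
  by nra.
have h0 := IH br fE uf; have h1 := label_prod2 eE ve ue uv.
have h2 := label_sum2 eE fE ue uf fe.
rewrite leNgt; apply/negP => h3.
have h4 : B v e * B u e < (1 - g) * B u e by rewrite ltr_pM2r // (label_gt0 L).
have h5 : (1 - g) * B u e <= (1 - g) * g by rewrite ler_pM2l; lra.
by nra.
Qed.

Lemma active_label e u : e \in E -> u \in e -> active H e u -> B u e <= g.
Proof.
have /andP[g1 g2] := golden_bounds => eE ue [d3|[f [x [fE uf fe b br]]]].
  by have := label_degree3 eE ue d3; lra.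
by have := beyond_label b br fE uf; have := label_sum2 eE fE ue uf fe; lra.
Qed.

(** Each active vertex leaves at most g to e, and g * g * g = alpha. *)
Lemma active_unique e v u u' : e \in E -> v \in e -> u \in e -> u' \in e ->
  uniq [:: v; u; u'] -> B v e < g -> active H e u -> active H e u' -> False.
Proof.
move=> eE ve ue ue' U vg /(active_label eE ue) au /(active_label eE ue') au'.
have := label_prod3 eE ve ue ue' U.
have /andP[g1 g2] := golden_bounds; have gg' := golden_eq L.
have h1 : B u e * B u' e <= g * g by apply: ler_pM; rewrite // ltW // (label_gt0 L).
have h2 : B v e * (g * g) < g * (g * g) by rewrite ltr_pM2r // gg'; lra.
have h3 : B v e * (B u e * B u' e) <= B v e * (g * g).
  by apply: ler_wpM2l => //; rewrite ltW // (label_gt0 L).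
rewrite gg' (mulrBr g) gg' mulr1 in h2; rewrite gg' in h3; move: h2 h3; rewrite -!mulrA; lra.
Qed.

Lemma active_root_unique v u : v \in F -> u \in F -> u != v ->
  active H F v -> active H F u -> False.
Proof.
move=> vF uF uv /(active_label FE vF) av /(active_label FE uF) au.
have := root_pair vF uF uv.
have : B v F * B u F <= g * g by apply: ler_pM; rewrite // ltW // (label_gt0 L).
by rewrite (golden_eq L); lra.
Qed.

Lemma branching4_degree e v : branching_edge H 4 e -> v \in e -> degree H v = 2%N.
Proof.
move=> br ve; have /and3P[eE _ _] := br; have [x [y [z [[xe ye ze] U ee]]]] := edge_enum eE ve.
move: (branching_edge_sum br ve U ee).
move: (branching_degree br ve) (branching_degree br xe).
move: (branching_degree br ye) (branching_degree br ze).
by do 4! case: degree => [|[|[|?]]] //.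
Qed.

(** The two remaining vertices of e have degree two, hence labels at most 2 - 2
    * g; already g * g * (2 - 2 * g) ^+ 2 is less than alpha. *)
Lemma branching4_inactive e v u : branching_edge H 4 e -> v \in e -> u \in e ->
  u != v -> B v e < g -> ~ active H e u.
Proof.
move=> br ve ue uv vg a; have /and3P[eE _ _] := br.
have au := active_label eE ue a.
have [x [y [z [[xe ye ze] U ee]]]] := edge_enum eE ve.
have d c : c \in e -> B c e <= 2 - 2 * g.
  by move=> ce; apply: label_degree2 => //; rewrite (branching4_degree br ce).
have B0 c : c \in e -> 0 <= B c e by move=> ce; rewrite ltW // (label_gt0 L).
have /andP[g1 g2] := golden_bounds; have gg' := golden_eq L.
have key p q : p \in e -> q \in e -> uniq [:: v; u; p; q] -> False.
  move=> pe qe Upq; have := label_prod4 eE ve ue pe qe Upq.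
  have h1 : B v e * B u e <= g * g by apply: ler_pM; rewrite // ?B0 ?(ltW vg).
  have h2 : B p e * B q e <= (2 - 2 * g) * (2 - 2 * g).
    by apply: ler_pM; rewrite ?B0 ?d.
  have h3 : (B v e * B u e) * (B p e * B q e) <=
      (g * g) * ((2 - 2 * g) * (2 - 2 * g)).
    by apply: ler_pM; rewrite // mulr_ge0 ?B0.
  move: h3; rewrite gg'.
  rewrite golden_product.
  by rewrite !mulrA; lra.
move: U ue; rewrite ee /= !inE !negb_or (negbTE uv) /=.
move=> /and4P[/and3P[a1 b1 c1] /andP[d1 k1] h1 _].
case/or3P=> /eqP uu; rewrite uu in key.
- by apply: (key y z) => //; rewrite /= !inE !negb_or a1 b1 c1 d1 k1 h1.
- by apply: (key x z) => //; rewrite /= !inE !negb_or a1 b1 c1 (eq_sym y) d1 k1 h1.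
- by apply: (key x y) => //; rewrite /= !inE !negb_or a1 b1 c1 d1 !(eq_sym z) k1 h1.
Qed.

Lemma near_vertex e : e \in E -> e != F ->
  exists e0 v, [/\ arrives e0 v, v \in e & e != e0].
Proof.
move=> eE eF; have /card_gt0P[u ue] : (0 < #|e|)%N by rewrite (uniform eE).
have [e' A] := arrives_all u conn.
have [ee'|ee'] := eqVneq e e'; last by exists e', u.
move: A => [v0 [w [v0F N le _]]]; case/lastP: w => [|w [f x]] in N le *.
  by rewrite ee' -le eqxx in eF.
move: N; rewrite -cats1 nbw_cat => /andP[N /= /and5P[_ h1 h2 _ _]].
rewrite /unzip1 map_rcons last_rcons /= in le.
exists (last F (unzip1 w)), (last v0 (unzip2 w)).
by rewrite ee' -le; split=> //; exists v0, w.
Qed.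

Lemma beyond_root x :
  (if x is inr e then e \in E else true) ->
  [\/ x = inr F, exists2 v, v \in F & x = inl v |
   exists v e, [/\ v \in F, e \in E, v \in e, e != F & beyond H v e x]].
Proof.
have key e u : arrives e u -> [/\ e = F & u \in F] \/
    exists v f, [/\ v \in F, f \in E, v \in f, f != F &
      beyond H v f (inr e) /\ beyond H v f (inl u)].
  case=> v0 [[|[f y] w] [v0F N le lu]]; first by left; rewrite -le -lu.
  right; exists v0, f; move: (N); rewrite nbw_cons => /and5P[fE vf fF _ _].
  rewrite last_unzip1 in le; rewrite last_unzip2 in lu.
  by rewrite -le -lu; split=> //; apply: nbw_beyond N.
case: x => [u _|e eE].
  have [e A] := arrives_all u conn.
  case: (key _ _ A) => [[_ uF]|[v [f [vF fE vf fF [_ b]]]]].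
    by constructor 2; exists u.
  by constructor 3; exists v, f.
have [->|eF] := eqVneq e F; first by constructor 1.
have [e0 [v [A ve ee0]]] := near_vertex eE eF.
have [u ue uv] := edge_other eE ve.
have A' := arrives_step A eE ve ee0 ue uv.
case: (key _ _ A') => [[/eqP]|[v' [f [vF fE vf fF [b _]]]]].
  by rewrite (negbTE eF).
by constructor 3; exists v', f.
Qed.

(** The edge of arrival takes more than 1 - g and the third edge at least alpha. *)
Lemma near_label3 e0 e v : arrives e0 v -> e \in E -> v \in e -> e != e0 ->
  degree H v = 3%N -> B v e < 1 - g.
Proof.
move=> A eE ve ee0 d3; have [e0E ve0 lb] := arrivesP A.
have [h hE] : exists2 h, h \in [set f in E | v \in f] & h \notin [set e0; e].
  apply/subsetPn; apply: contraTN isT => /subset_leq_card.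
  by rewrite -/(degree H v) d3 cards2 ltnNge; case: (e0 == e).
move: hE; rewrite !inE negb_or => /andP[hE vh] /andP[he0 he].
have := label_sum3 e0E eE hE ve0 ve vh; rewrite /= !inE negb_or.
rewrite ![e0 == _]eq_sym ee0 he0 eq_sym he => /(_ isT).
by have := label_ge hE vh; lra.
Qed.

Lemma branching_vertex_last e0 u f x : arrives e0 u -> degree H u = 3%N ->
  f \in E -> u \in f -> f != e0 -> beyond H u f x -> ~~ branching_item H x.
Proof.
move=> A d3 fE uf fe b; apply/negP => br.
have := beyond_label b br fE uf; have := near_label3 A fE uf fe d3.
by lra.
Qed.

Lemma degree2_edge e f h u : degree H u != 3%N -> e \in E -> f \in E -> h \in E ->
  u \in e -> u \in f -> u \in h -> f != e -> h = e \/ h = f.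
Proof.
move=> d3 eE fE hE ue uf uh fe.
have [he|he] := eqVneq h e; first by left.
have [hf|hf] := eqVneq h f; first by right.
have := degree_gt2 eE fE hE ue uf uh.
rewrite /= !inE negb_or ![e == _]eq_sym fe he eq_sym hf => /(_ isT).
have := degree_le3 u.
by case: degree d3 => [|[|[|[|]]]].
Qed.

(** Since e has at most one active vertex, the walk to follow is forced. It
    stops at a vertex of degree three or at a 4-branching edge, after which
    nothing branches. *)
Lemma spine e0 v : arrives e0 v -> forall e, e \in E -> v \in e -> e != e0 ->
  exists u w, [/\ nbw H e0 v ((e, u) :: w),
    forall x, beyond H v e x -> branching_item H x -> x \in items ((e, u) :: w)
    & pairwise (may_precede H) (items ((e, u) :: w))].
Proof.
move: e0 v; apply: arrives_ind => e0 v A IH e eE ve ee0.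
have vg := near_label A eE ve ee0.
have branch3 u : branching_item H (inl u) -> degree H u = 3%N by move/eqP.
have [[u [ue uv au]]|none] := pselect (exists u, [/\ u \in e, u != v & active H e u]);
  last first.
  have [u ue uv] := edge_other eE ve; exists u, [::]; split.
  - by rewrite /= eE ve ee0 ue uv.
  - move=> x b br; case: (beyondP b br) => [->|[u' /andP[u'e u'v] [a _]]].
      by rewrite inE eqxx.
    by case: none; exists u'.
  rewrite /= /may_precede /= !andbT; apply/negP => /andP[_ /branch3 d3].
  by case: none; exists u; split=> //; left.
have uniq_u u' : u' \in e -> u' != v -> active H e u' -> u' = u.
  move=> u'e u'v a; apply/eqP; apply/negPn/negP => u'u.
  apply: (active_unique eE ve ue u'e) vg au a.
  by rewrite /= !inE negb_or ![v == _]eq_sym uv u'v eq_sym u'u.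
have not4 : is_branching4_edge_or_vertex H (inr e) = false.
  apply/negP => /= b4.
  exact: (branching4_inactive b4 ve ue uv vg au).
have A' := arrives_step A eE ve ee0 ue uv.
have [d3|d3] := eqVneq (degree H u) 3%N.
  exists u, [::]; split.
  - by rewrite /= eE ve ee0 ue uv.
  - move=> x b br; case: (beyondP b br) => [->|[u' /andP[u'e u'v] [a]]].
      by rewrite inE eqxx.
    have -> := uniq_u _ u'e u'v a; case=> [[-> _]|[f [fE uf fe b']]].
      by rewrite !inE eqxx orbT.
    by have /negP := branching_vertex_last A' d3 fE uf fe b'.
  by rewrite /= /may_precede not4.
case: au => [/eqP|[f [y [fE uf fe by' bry]]]]; first by rewrite (negbTE d3).
have [u1 [w [N cov pw]]] := IH e u eE ve ee0 ue uv f fE uf fe.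
exists u, ((f, u1) :: w); split.
- by rewrite nbw_cons eE ve ee0 ue uv N.
- move=> x b br; rewrite /items /= -/(items _) !inE.
  case: (beyondP b br) => [->|[u' /andP[u'e u'v] [a]]]; first by rewrite eqxx.
  have -> := uniq_u _ u'e u'v a; case=> [[-> _]|[h [hE uh he b']]].
    by rewrite eqxx orbT.
  have hf : h = f.
    have [/eqP|//] := degree2_edge d3 eE fE hE ue uf uh fe.
    by rewrite (negbTE he).
  by move: (cov x); rewrite -hf => /(_ b' br); rewrite /items /= !inE hf => ->; rewrite !orbT.
have -> : items ((e, u) :: (f, u1) :: w) =
  inr e :: inl u :: items ((f, u1) :: w) by [].
rewrite 2!pairwise_cons pw andbT; apply/andP; split; apply/allP => c _.
  by rewrite /may_precede not4.
by rewrite /may_precede /= /branching_vertex (negbTE d3).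
Qed.

Local Notation q := (2 - 2 * g).

(** The bound 1 - k * alpha of label_degree is weakened to (1 - alpha) ^+ k, in
    which the degrees of the vertices of an edge add up. *)
Lemma label_pow e u : e \in E -> u \in e -> B u e <= q ^+ (degree H u).-1.
Proof.
move=> eE ue; have /andP[g1 g2] := golden_bounds; have gg' := golden_eq L.
have [d1|d1] := leqP (degree H u) 1%N.
  by case: degree d1 => [|[|]] // _; rewrite expr0 (label_le1).
have [d2|d2] := eqVneq (degree H u) 3%N.
  rewrite d2 expr2; apply: le_trans (label_degree3 eE ue d2) _.
  have -> : q * q = 4 - 8 * g + 4 * (g * g) by ring.
  by rewrite gg'; lra.
have -> : degree H u = 2%N by move: d1 d2 (degree_le3 u); case: degree => [|[|[|[|]]]].
by rewrite expr1; apply: (label_degree2).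
Qed.

Lemma near_label_pow e0 e v : arrives e0 v -> e \in E -> v \in e -> e != e0 ->
  B v e <= g * q ^+ (degree H v).-2.
Proof.
move=> A eE ve ee0; have [e0E ve0 lb] := arrivesP A.
have /andP[g1 g2] := golden_bounds; have gg' := golden_eq L.
have d1 := degree_gt1 e0E eE ve0 ve ee0.
have [d2|d2] := eqVneq (degree H v) 3%N; last first.
  have -> : degree H v = 2%N by move: d1 d2 (degree_le3 v); case: degree => [|[|[|[|]]]].
  by rewrite expr0 mulr1 ltW // (near_label A).
rewrite d2 expr1.
have := near_label3 A eE ve ee0 d2; rewrite mulrBr mulrCA gg'.
by lra.
Qed.

(** If e is not F and has n incident edges, its labels multiply to at most
    g * (2 - 2 * g) ^+ n.-1, and g * (2 - 2 * g) ^+ 4 is less than alpha. *)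
Lemma incident_le4 e : e \in E -> (#|incident_edges H e| <= 4)%N.
Proof.
move=> eE; have [->|eF] := eqVneq e F.
  rewrite (card_incident Hac FE).
  under eq_bigr => v vF do rewrite (root_degree vF).
  by rewrite sum1_card (uniform FE).
have [e0 [v [A ve ee0]]] := near_vertex eE eF.
have [x [y [z [[xe ye ze] U ee]]]] := edge_enum eE ve.
rewrite (card_incident Hac eE) (eq_bigl (mem [:: v; x; y; z])) //.
rewrite -big_uniq //= !big_cons big_nil addn0 leqNgt; apply/negP => big.
have [e0E ve0 _] := arrivesP A.
have d1 := degree_gt1 e0E eE ve0 ve ee0.
have /andP[g1 g2] := golden_bounds; have gg' := golden_eq L.
set k := ((degree H v).-2 + (degree H x).-1 + (degree H y).-1 + (degree H z).-1)%N.
have k4 : (4 <= k)%N.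
  rewrite /k; move: big d1; case: (degree H v) => [|[|a]] //= + _.
  by rewrite addSn ltnS !addnA.
have := label_prod4 eE ve xe ye ze U.
have : B v e * B x e * B y e * B z e <= g * q ^+ k.
  have B0 c : c \in e -> 0 <= B c e by move=> ce; rewrite ltW // (label_gt0 L).
  rewrite /k !exprD !mulrA; do 3 (apply: ler_pM;
     rewrite ?mulr_ge0 ?B0 //; last by apply: label_pow).
  exact: near_label_pow A eE ve ee0.
have : g * q ^+ k <= g * q ^+ 4.
  rewrite ler_pM2l; last by lra.
  by apply: ler_wiXn2l => //; lra.
have -> : g * q ^+ 4 = 544 * g - 336.
  apply/eqP; rewrite -subr_eq0.
  have -> : g * q ^+ 4 - (544 * g - 336) = (g * g - (1 - g)) *
      (16 * (g * g * g) - 80 * (g * g) + 192 * g - 336) by ring.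
  by rewrite gg' subrr mul0r.
by move=> h1 h2 h3; move: (le_trans h3 (le_trans h2 h1)) => {k k4 h1 h2 h3}; lra.
Qed.

(** An edge with at most two incident edges and no vertex of degree three has at
    most one vertex besides v where the walk can continue. *)
Lemma unbranched_path e0 v : arrives e0 v -> forall e, e \in E -> v \in e ->
  e != e0 -> degree H v = 2%N ->
  (forall x, beyond H v e x -> ~~ branching_item H x) ->
  exists u w, [/\ nbw H e0 v ((e, u) :: w), hanging_path H v ((e, u) :: w)
    & path_label (size w).+1 <= B v e].
Proof.
move: e0 v; apply: arrives_ind => e0 v A IH.
move=> e eE ve ee0 dv plain.
have d2 x : x \in e -> (degree H x <= 2)%N.
  move=> xe; have [->|xv] := eqVneq x v; first by rewrite dv.
  have := plain (inl x) (BeyondVertex H xe xv); have := degree_le3 x.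
  by rewrite /branching_item /= /branching_vertex; case: degree => [|[|[|[|]]]].
have inc : (#|incident_edges H e| <= 2)%N.
  have := plain (inr e) (BeyondEdge H v e); have := incident_le4 eE.
  rewrite /branching_item /= /branching_edge eE /=.
  have -> : [forall v0 in e, ~~ branching_vertex H 3 v0].
    apply/forallP => x; apply/implyP => xe; have := d2 x xe.
    by rewrite /branching_vertex; case: degree => [|[|[|]]].
  by case: (#|_|) => [|[|[|[|[|]]]]].
have one u x : u \in e -> x \in e -> u != v -> x != v ->
    (1 < degree H u)%N -> (1 < degree H x)%N -> x = u.
  move=> ue xe uv xv du dx; apply/eqP/negPn/negP => xu.
  move: inc; rewrite (card_incident Hac eE) (bigD1 v) //= dv.
  rewrite (bigD1 u) ?ue //= (bigD1 x) ?xe ?xv //=.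
  apply/negP; rewrite -ltnNge; case: (degree H u) du => [|[|a]] // _.
  by case: (degree H x) dx => [|[|b]] //= _; rewrite !(addSn, addnS).
have [[u [ue uv du]]|none] := pselect (exists u, [/\ u \in e, u != v & (1 < degree H u)%N]);
  last first.
  have [u ue uv] := edge_other eE ve; exists u, [::]; split.
  - by rewrite /= eE ve ee0 ue uv.
  - split=> // x h xe xv hE xh; left; apply/eqP/negPn/negP => he.
    by case: none; exists x; split=> //; apply: degree_gt1 eE hE xe xh he.
  by rewrite /= subr0 divr1 (label_ge).
have [f] : exists2 f, f \in [set f in E | u \in f] & f \notin [set e].
  apply/subsetPn; apply: contraTN du => /subset_leq_card.
  by rewrite -/(degree H u) cards1 -leqNgt.
rewrite !inE => /andP[fE uf] fe.
have du2 : degree H u = 2%N by apply/eqP; rewrite eqn_leq d2.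
have [|u1 [w [N T lb]]] := IH e u eE ve ee0 ue uv f fE uf fe du2.
  by move=> x b; apply: plain; apply: BeyondNext b.
exists u, ((f, u1) :: w); split.
- by rewrite nbw_cons eE ve ee0 ue uv N.
- split=> // x h xe xv hE xh; have [->|he] := eqVneq h e; first by left.
  right; have xu : x = u.
    by apply: one => //; apply: degree_gt1 eE hE xe xh he.
  split=> //=; congr Some; rewrite xu in xh.
  have du3 : degree H u != 3%N by rewrite du2.
  have [/eqP|//] := degree2_edge du3 eE fE hE ue uf xh fe.
  by rewrite (negbTE he).
rewrite [path_label _]/= -[_ / (1 - path_label _)]/(path_label (size w).+1).
have h1 := label_sum2 eE fE ue uf fe; have h2 := label_gt0 L eE ue.
have h3 := label_prod2 eE ve ue uv; have h4 := label_gt0 L eE ve.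
set p := path_label (size w).+1 in lb *.
change (alpha / (1 - p) <= B v e).
rewrite ler_pdivrMr; last by lra.
apply: le_trans h3 _; rewrite ler_pM2l //.
by lra.
Qed.

End Branching.

(** * Daggers and quipus *)

Local Notation room n := (1 - path_label n)%R.
Local Notation big := (is_branching4_edge_or_vertex H).
Local Notation br := (branching_item H).

Definition path_branch e0 v s :=
  [/\ attached_path H e0 v s, 0 < size s, (B v e0 <= room (size s))%R &
      forall h, h \in E -> v \in h -> h = e0 \/ h = head set0 s].

Lemma inactive_branch e0 v : arrives e0 v -> degree H v = 2 ->
  ~ active H e0 v -> exists s, path_branch e0 v s.
Proof.
move=> A dv inact; have [e0E ve0 _] := arrivesP A.
have [e] : exists2 e, e \in [set f in E | v \in f] & e \notin [set e0].
  apply/subsetPn; apply: contra_eqT dv => /negPn/subset_leq_card.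
  by rewrite -/(degree H v) cards1; case: degree => [|[|]].
rewrite !inE => /andP[eE ve] ee0.
have plain x : beyond H v e x -> ~~ branching_item H x.
  by move=> b; apply/negP => br; apply: inact; right; exists e, x.
have [u [w [N T lb]]] := unbranched_path A eE ve ee0 dv plain.
have dv3 : degree H v != 3 by rewrite dv.
have v2 h : h \in E -> v \in h -> h = e0 \/ h = e.
  by move=> hE vh; apply: (degree2_edge dv3).
have /andP[U _] := arrives_uniq A N.
exists (unzip1 ((e, u) :: w)); split=> //.
- exact: (hanging_path_attached (w := (e, u) :: w) Hac e0E ve0 isT N T U v2).
- by rewrite /= size_map; have := label_sum2 e0E eE ve0 ve ee0; move: lb => /=; lra.
Qed.

(** If v leads further, so that e0 has at most g there, the three other paths
    must have lengths 1, 1 and at most 3. *)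
Lemma quipu_end e0 v : e0 \in E -> v \in e0 -> (B v e0 <= g)%R ->
  (forall u, u \in e0 -> u != v -> exists s, path_branch e0 u s) ->
  exists2 k, k \in [:: 1; 2; 3] & has_attached_paths H e0 [tuple 1; 1; k].
Proof.
move=> e0E ve0 vg br.
have [S hS] : exists S, forall u, u \in e0 -> u != v -> path_branch e0 u (S u).
  apply: (@fin_all_exists _ _ (fun u s => u \in e0 -> u != v -> path_branch e0 u s)).
  move=> u; have [ue|ue] := boolP (u \in e0); last by exists [::].
  have [->|uv] := eqVneq u v; first by exists [::].
  by have [s hs] := br u ue uv; exists s.
have [x [y [z [_ U ee]]]] := edge_enum e0E ve0.
pose le := relpre (size \o S) leq.
have /(sort_sorted (leT := le)) : total le by move=> a b; apply: leq_total.
move=> /(_ [:: x; y; z]); have := permEl (perm_sort le [:: x; y; z]).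
have := size_sort le [:: x; y; z].
case: (sort le _) => [|a [|b [|c []]]] // _ P; rewrite /= /le /= => /and3P[ab bc _].
have eabc u : u \in [:: a; b; c] -> (u \in e0) && (u != v).
  rewrite (perm_mem P) => uxyz; rewrite ee in_cons uxyz orbT /=.
  by apply: contraTneq U => <-; rewrite cons_uniq uxyz.
have Uv : uniq [:: v; a; b; c].
  rewrite cons_uniq (perm_uniq P) (perm_mem P).
  by move: U; rewrite cons_uniq.
have pb u : u \in [:: a; b; c] -> path_branch e0 u (S u).
  by move=> /eabc/andP[ue uv]; apply: hS.
have [/andP[ae _] /andP[be _] /andP[ce _]] :
    [/\ (a \in e0) && (a != v), (b \in e0) && (b != v) & (c \in e0) && (c != v)].
  by split; apply: eabc; rewrite !inE eqxx ?orbT.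
have [_ a0 ra _] : path_branch e0 a (S a) by apply: pb; rewrite !inE eqxx.
have [_ b0 rb _] : path_branch e0 b (S b) by apply: pb; rewrite !inE eqxx ?orbT.
have [_ c0 rc _] : path_branch e0 c (S c) by apply: pb; rewrite !inE eqxx ?orbT.
have abc : size (S a) <= size (S b) <= size (S c) by rewrite ab bc.
have [|la lb lc] := @quipu_lengths (size (S a)) (size (S b)) (size (S c)) a0 abc.
  apply: le_trans (label_prod4 e0E ve0 ae be ce Uv) _.
  by apply: prod4_le; rewrite // ltW // (label_gt0 L).
exists (size (S c)); first by move: lc; case: size => [|[|[|[|]]]].
have -> : [tuple 1; 1; size (S c)] = map_tuple (size \o S) [tuple a; b; c].
  by apply/val_inj; rewrite /= la lb.
exists (tnth [tuple a; b; c]), (S \o tnth [tuple a; b; c]).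
apply: attached_paths_seq => [|u /pb[]|u h /pb[]] //.
  by move: Uv; rewrite cons_uniq => /andP[].
by move=> _ _ _ + hE uh; apply.
Qed.

(** The edges of the four hanging paths, together with F, are closed under
    adjacency, hence exhaust the connected H. *)
Lemma no_active_dagger : (forall v, v \in F -> ~ active H F v) ->
  [\/ is_dagger H 1 2 2 2, is_dagger H 1 2 2 3,
      is_dagger H 1 1 4 4 | is_dagger H 1 1 4 5] \/
  exists k l, 1 <= k <= 3 /\ k <= l /\ is_dagger H 1 1 k l.
Proof.
move=> inact.
have [S hS] : exists S, forall u, u \in F -> path_branch F u (S u).
  apply: (@fin_all_exists _ _ (fun u s => u \in F -> path_branch F u s)).
  move=> u; have [uF|uF] := boolP (u \in F); last by exists [::].
  have [s hs] := inactive_branch (arrives_root uF) (root_degree uF) (inact u uF).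
  by exists s.
have /card_gt0P[v vF] : 0 < #|F| by rewrite (uniform FE).
have [x [y [z [_ U ee]]]] := edge_enum FE vF.
pose le := relpre (size \o S) leq.
have /(sort_sorted (leT := le)) : total le by move=> a b; apply: leq_total.
move=> /(_ [:: v; x; y; z]); have := permEl (perm_sort le [:: v; x; y; z]).
have := size_sort le [:: v; x; y; z].
case: (sort le _) => [|a [|b [|c [|d []]]]] // _ P.
rewrite /= /le /= => /and4P[ab bc cd _].
have Fabcd u : (u \in [:: a; b; c; d]) = (u \in F) by rewrite (perm_mem P) ee.
have Uabcd : uniq [:: a; b; c; d] by rewrite (perm_uniq P).
have pb u : u \in [:: a; b; c; d] -> path_branch F u (S u).
  by rewrite Fabcd; apply: hS.
have closed e f u : e \in E -> f \in E -> u \in e -> u \in f ->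
    e = F \/ (exists2 t, t \in F & e \in S t) ->
    f = F \/ (exists2 t, t \in F & f \in S t).
  move=> eE fE ue uf eC.
  have atF : u \in F -> f = F \/ (exists2 t, t \in F & f \in S t).
    move=> uF; have [_ s0 _ only] := hS u uF.
    case: (only f fE uf) => [->|->]; [by left|right; exists u => //].
    by rewrite -nth0 mem_nth.
  case: eC => [eF|[t tF et]]; first by apply: atF; rewrite -eF.
  have [[_ _ _ cl] _ _ _] := hS t tF.
  have [fs|fs] := boolP (f \in S t); first by right; exists t.
  have /subsetP/(_ u) := cl f fE fs; rewrite in_setI uf bigcup_seq.
  have -> : u \in \bigcup_(h in S t) h by apply/bigcupP; exists e.
  by rewrite in_set1 => /(_ isT)/eqP ut; apply: atF; rewrite ut.
have allE e u : arrives e u -> e = F \/ (exists2 t, t \in F & e \in S t).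
  have walkC w e1 v1 : e1 \in E -> v1 \in e1 -> nbw H e1 v1 w ->
      e1 = F \/ (exists2 t, t \in F & e1 \in S t) ->
      last e1 (unzip1 w) = F \/
      (exists2 t, t \in F & last e1 (unzip1 w) \in S t).
    elim: w e1 v1 => [|[f p] w IH] e1 v1 e1E v1e //.
    rewrite nbw_cons => /and5P[fE vf _ pf /andP[_ N]] e1C.
    exact: (IH f p fE pf N (closed _ _ _ e1E fE v1e vf e1C)).
  by case=> v0 [w [v0F N <- _]]; apply: (walkC w F v0) => //; left.
have dag : is_dagger H (size (S a)) (size (S b)) (size (S c)) (size (S d)).
  exists F, (tnth [tuple a; b; c; d]), (S \o tnth [tuple a; b; c; d]); split.
  - have -> : [tuple size (S a); size (S b); size (S c); size (S d)] =
      map_tuple (size \o S) [tuple a; b; c; d] by apply/val_inj.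
    apply: attached_paths_seq => [|u /pb[]|u h /pb[]] //.
    by move=> _ _ _ + hE uh; apply.
  - move=> e eE; have eC : e = F \/ (exists2 t, t \in F & e \in S t).
      have [->|eF] := eqVneq e F; first by left.
      have [e0 [u [A ue _]]] := near_vertex eE eF.
      have [e0E ue0 _] := arrivesP A.
      by apply: closed (allE _ _ A); [exact: e0E|exact: eE|exact: ue0|exact: ue].
    case: eC => [->|[t tF et]]; [by left|right].
    have /tnthP[i ti] : t \in [tuple a; b; c; d] by rewrite Fabcd.
    by exists i; rewrite /= -ti.
  move=> u; have [e A] := arrives_all u conn.
  by have [eE ue _] := arrivesP A; exists e.
have [aF bF cF dF] : [/\ a \in F, b \in F, c \in F & d \in F].
  by split; rewrite -Fabcd !inE eqxx ?orbT.
have [_ a0 ra _] := hS a aF; have [_ b0 rb _] := hS b bF.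
have [_ c0 rc _] := hS c cF; have [_ d0 rd _] := hS d dF.
have abcd : [&& size (S a) <= size (S b), size (S b) <= size (S c) &
    size (S c) <= size (S d)] by rewrite ab bc cd.
have [|M|[la lb lc]] :=
  @dagger_lengths (size (S a)) (size (S b)) (size (S c)) (size (S d)) a0 abcd.
- apply: le_trans (label_prod4 FE aF bF cF dF Uabcd) _.
  by apply: prod4_le; rewrite // ltW // (label_gt0 L).
- left; move: M dag; rewrite !inE.
  by case/or4P=> /eqP[-> -> -> ->]; [constructor 1|constructor 2|constructor 3|constructor 4].
right; exists (size (S c)), (size (S d)); split=> //; split=> //.
by move: dag; rewrite la lb.
Qed.

Lemma branching4_end e : branching_edge H 4 e ->
  (exists2 v, v \in F & active H F v) ->
  exists2 k, k \in [:: 1; 2; 3] & has_attached_paths H e [tuple 1; 1; k].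
Proof.
move=> b4 [v1 v1F act]; have /and3P[eE _ _] := b4.
have [eF|eF] := eqVneq e F.
  subst e; apply: (quipu_end FE v1F (active_label FE v1F act)).
  move=> u uF uv; apply: (inactive_branch (arrives_root uF)).
    exact: (root_degree uF).
  by apply: (active_root_unique v1F uF uv act).
have [e0 [v [A ve ee0]]] := near_vertex eE eF.
have vg := near_label A eE ve ee0.
apply: (quipu_end eE ve (ltW vg)) => u ue uv.
apply: (inactive_branch (arrives_step A eE ve ee0 ue uv)).
  exact: (branching4_degree b4).
exact: (branching4_inactive b4 ve ue uv vg).
Qed.

(** Otherwise the walk could be prolonged through F. *)
Lemma root_not_revisited v1 v0 w : v1 \in F -> v0 \in F -> v0 != v1 ->
  nbw H F v1 w -> v0 \notin unzip2 w.
Proof.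
move=> v1F v0F v01 N; apply/negP => /mapP[[e u] /= + uu]; rewrite -{}uu.
move=> /splitPr eaw; case: eaw N => w1 w2; rewrite -cat_rcons nbw_cat => /andP[N _].
have := nbw_root_uniq v1F N.
rewrite {1}/unzip1 map_rcons cons_uniq mem_rcons inE negb_or /= => /andP[/andP[/andP[Fe _] _] _].
have := @nbw_root_uniq v1 (rcons w1 (e, v0) ++ [:: (F, v1)]) v1F.
rewrite nbw_cat N /= /unzip1 /unzip2 !map_cat !map_rcons !last_rcons /=.
rewrite FE v0F v1F Fe (eq_sym v1) v01 /= !mem_cat !inE eqxx orbT.
by move=> /(_ isT).
Qed.

(** The path consists of another vertex of F, then F, and then the spine through
    the only active vertex of F. *)
Lemma active_quipu : (exists2 v, v \in F & active H F v) -> open_quipu H.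
Proof.
move=> act; have [v1 v1F act1] := act.
have inact u : u \in F -> u != v1 -> ~ active H F u.
  by move=> uF uv; apply: (active_root_unique v1F uF uv).
have F2 u : u \in F -> degree H u = 2 by move=> ?; apply: (root_degree).
have [f [fE v1f fF]] : exists f, [/\ f \in E, v1 \in f & f != F].
  case: act1 => [|[f [_ [fE uf fF _ _]]]]; last by exists f.
  by rewrite F2.
have [u [w [N cov pw]]] := spine (arrives_root v1F) fE v1f fF.
have covF x v e : v \in F -> e \in E -> v \in e -> e != F -> beyond H v e x ->
    br x -> x \in items ((f, u) :: w).
  move=> vF eE ve eF b bx; have [vv|vv] := eqVneq v v1.
    move: vv eF => -> eF in vF ve b *; apply: cov bx.
    have d3 : degree H v1 != 3 by rewrite F2.
    have [/eqP|<- //] := degree2_edge d3 FE fE eE v1F v1f ve fF.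
    by rewrite (negbTE eF).
  by case: (inact v vF vv); right; exists e, x.
have br_root v : v \in F -> ~~ br (inl v).
  by move=> vF; rewrite /branching_item /= /branching_vertex F2.
have [v0 v0F v01] := edge_other FE v1F.
(* Starting one vertex before v1 makes the path pass through F itself. *)
set W := (F, v1) :: (f, u) :: w.
set p := path_items v0 W.
have pE : p = [:: inl v0, inr F, inl v1 & items ((f, u) :: w)] by [].
have covp x : (if x is inr e then e \in E else true) -> br x -> x \in p.
  move=> xE bx; rewrite pE 3!in_cons; case: (beyond_root xE) bx.
  - by move=> ->; rewrite eqxx orbT.
  - by case=> v vF -> /negPn; rewrite br_root.
  - by case=> v [e [vF eE ve eF b]] bx; rewrite (covF _ _ _ vF eE ve eF b bx) !orbT.
have /andP[U1 U2] := nbw_root_uniq v1F N.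
split.
- by split; [exact: conn|exact: Hac].
- exists v0, W; split.
  + have := root_not_revisited v1F v0F v01 N.
    rewrite /walk_path /W; move: U1 U2 (nbw_walk N).
    rewrite ![unzip1 ((F, _) :: _)]/= ![unzip2 ((F, _) :: _)]/= => U1 U2 wk nv.
    rewrite [walk _ _ _]/= -[[&& f \in E, _, _ & _]]/(walk H v1 ((f, u) :: w)) wk.
    rewrite FE v0F v1F U1 andbT /= -/(unzip2 _).
    move: U2 nv; rewrite /= !inE !negb_or => -> /andP[-> ->].
    by rewrite v01.
  + by move=> y b3; apply: covp.
  + move=> e /orP[] be; have /and3P[eE _ _] := be; apply: covp => //;
      by rewrite /branching_item /= be ?orbT.
  move=> a b c bet bb ba.
  (* F is exempted: only v0 precedes it on the path. *)
  have pr : pairwise (fun x y => may_precede H x y || (x == inr F)) p.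
    rewrite pE 3!pairwise_cons; apply/and4P; split.
    - by apply/allP => x _; rewrite /may_precede /= /branching_vertex F2.
    - by apply/allP => x _; rewrite eqxx orbT.
    - by apply/allP => x _; rewrite /may_precede /= /branching_vertex F2.
    - by apply: sub_pairwise pw => x y ->.
  have notF x y : before p x y -> y = inr F -> ~~ br x.
    have iF : index (inr F) p = 1 by rewrite pE /= eqxx.
    case/and3P=> _ _ + yF; rewrite yF iF pE /=.
    by case: eqP => // <- _; apply: br_root.
  have step x y : before p x y -> big x -> x = inr F \/ ~~ br y.
    case/and3P=> xp yp ixy bx.
    have := before_pairwise pr xp yp ixy; rewrite /may_precede bx /=.
    by case/orP=> [|/eqP]; [right|left].
  have bra : br a by rewrite /branching_item ba.
  suff : ~~ br c by rewrite negb_or => /andP.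
  case/orP: bet => /andP[h1 h2].
    have [bF|//] := step _ _ h2 bb.
    by have := notF _ _ h1 bF; rewrite bra.
  have [bF|] := step _ _ h2 bb; first exact: (notF _ _ h1 bF).
  by rewrite bra.
- have card_big : #|[set v | branching_vertex H 3 v]| +
      #|[set e | branching_edge H 4 e]| = #|[pred x | big x]|.
    rewrite -!sum1_card big_sumType /=.
    by congr (_ + _); apply: eq_bigl => x; rewrite !inE.
  rewrite card_big.
  have sub : {subset [pred x | big x] <= inr F :: filter big (items ((f, u) :: w))}.
    move=> x; rewrite inE => bx; rewrite in_cons mem_filter bx /=.
    have xE : is_true (if x is inr e then e \in E else true).
      by case: x bx => //= e /and3P[].
    have bx' : br x by rewrite /branching_item bx orbT.
    move: (covp x xE bx'); rewrite pE 3!in_cons.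
    case/or4P=> [/eqP xv|->|/eqP xv|->]; rewrite ?orbT //.
      by move: bx'; rewrite xv (negbTE (br_root _ v0F)).
    by move: bx'; rewrite xv (negbTE (br_root _ v1F)).
  have /subset_leq_card/leq_trans -> // : [pred x | big x] \subset
      inr F :: filter big (items ((f, u) :: w)) by apply/subsetP.
  apply: leq_trans (card_size _) _.
  change (size (filter big (items ((f, u) :: w))) <= 1).
  have : pairwise (may_precede H) (filter big (items ((f, u) :: w))).
    by apply: pairwise_filter pw.
  have : all big (filter big (items ((f, u) :: w))) by apply: filter_all.
  case: (filter _ _) => [|x [|y s]] //= /and3P[bx by' _] /andP[/andP[]].
  by rewrite /may_precede bx /branching_item by' orbT.
by move=> e b4; apply: branching4_end.
Qed.

Lemma rooted_structure :
  [/\ hypertree H,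
      forall v, degree H v <= 3,
      forall e, e \in edges H -> #|incident_edges H e| <= 4
    & open_quipu H \/
      ([\/ is_dagger H 1 2 2 2, is_dagger H 1 2 2 3,
           is_dagger H 1 1 4 4 | is_dagger H 1 1 4 5] \/
       exists k l, 1 <= k <= 3 /\ k <= l /\ is_dagger H 1 1 k l) ].
Proof.
split.
- by split; [exact: conn|exact: Hac].
- exact: (degree_le3).
- exact: (incident_le4).
have [act|none] := pselect (exists2 v, v \in F & active H F v).
  by left; apply: active_quipu.
right; apply: (no_active_dagger) => v vF av.
by apply: none; exists v.
Qed.
End Rooted.
End Labelled.

(** * The extremal vector *)

Section Extremal.
Local Open Scope ring_scope.
Variables (R : realType) (r : nat) (V : finType) (H : uhypergraph r V).
Hypothesis r_gt0 : (0 < r)%N.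
Implicit Types (x y : V -> R) (e : {set V}) (v : V).

Definition edge_sum x : R := \sum_(e in edges H) \prod_(v in e) x v.
Definition power_sum x : R := \sum_v x v ^+ r.

Lemma power_sum_ge0 x : (forall v, 0 <= x v) -> 0 <= power_sum x.
Proof. by move=> x0; apply: sumr_ge0 => v _; apply: exprn_ge0. Qed.

Lemma power_sum_gt0 x v : (forall v, 0 <= x v) -> x v != 0 -> 0 < power_sum x.
Proof.
move=> x0 xv; rewrite /power_sum (bigD1 v) //= ltr_pwDl //.
  by rewrite exprn_gt0 // lt_def xv x0.
by apply: sumr_ge0 => u _; apply: exprn_ge0.
Qed.

Lemma edge_sumZ c x : edge_sum (fun v => c * x v) = c ^+ r * edge_sum x.
Proof.
rewrite /edge_sum mulr_sumr; apply: eq_bigr => e eE.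
by rewrite big_split prodr_const /= (uniform eE).
Qed.

Lemma power_sumZ c x : power_sum (fun v => c * x v) = c ^+ r * power_sum x.
Proof. by rewrite /power_sum mulr_sumr; apply: eq_bigr => v _; rewrite exprMn. Qed.

(** The quotient is homogeneous of degree 0. Division by the largest coordinate
    brings any admissible vector into the unit cube and makes its power sum
    at least 1, which defines a compact set where the quotient is
    continuous. *)
Lemma quotient_max_exists (v0 : V) : exists x, [/\ forall v, 0 <= x v,
    exists v, x v != 0 &
    forall y, (forall v, 0 <= y v) -> (exists v, y v != 0) ->
      edge_quotient H y <= edge_quotient H x].
Proof.
pose n := #|V|.
pose ev (z : 'rV[R]_n) (v : V) : R := z ord0 (enum_rank v).
have ev_cont v : continuous (fun z => ev z v) by apply: coord_continuous.
have add_cont : continuous (fun z : R * R => z.1 + z.2) by apply: add_continuous.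
have mul_cont : continuous (fun z : R * R => z.1 * z.2).
  by move=> z; apply: cvgM; [apply: cvg_fst|apply: cvg_snd].
have S_cont : continuous (power_sum \o ev).
  apply: (continuous_big add_cont) => v _ z.
  apply: (@continuous_comp _ _ _ (fun z => ev z v) (fun s => s ^+ r)).
    exact: ev_cont.
  exact: exprn_continuous.
have P_cont : continuous (edge_sum \o ev).
  apply: (continuous_big add_cont) => e _.
  by apply: (continuous_big mul_cont) => v _; apply: ev_cont.
pose box : set 'rV[R]_n := [set z | forall i, `[0, 1]%classic (z ord0 i)]%classic.
pose K := (box `&` [set z | 1 <= power_sum (ev z)])%classic.
have cK : compact K.
  apply: compact_closedI.
    have := @rV_compact R n (fun=> `[0, 1]%classic); apply=> _; exact: segment_compact.
  have /continuous_closedP/(_ _ (@closed_ge R 1)) := S_cont.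
  by [].
have ev_row x : ev (\row_i x (enum_val i)) = x.
  by apply/funext => v; rewrite /ev mxE enum_rankK.
have inK x v : (forall u, 0 <= x u <= 1) -> x v = 1 -> K (\row_i x (enum_val i)).
  move=> x01 xv; split; first by move=> i /=; rewrite mxE in_itv /=.
  rewrite /= ev_row /power_sum (bigD1 v) //= xv expr1n lerDl.
  by apply: sumr_ge0 => u _; apply: exprn_ge0; case/andP: (x01 u).
have K0 : (K !=set0)%classic.
  exists (\row_i (fun=> 1) (enum_val i)); apply: (@inK (fun=> 1) v0) => // u.
  by rewrite ler01 lexx.
have Q_cont : ({within K, continuous (edge_quotient H \o ev)})%classic.
  apply: continuous_in_subspaceT => z /set_mem[_ /= S1].
  apply: (@continuousM _ _ (edge_sum \o ev) (fun z => (power_sum (ev z))^-1)).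
    exact: P_cont.
  apply: (@continuousV _ _ (power_sum \o ev)); last exact: S_cont.
  by rewrite gt_eqF // (lt_le_trans _ S1).
have [z zK zmax] := compact_EVT_max K0 cK Q_cont.
case/set_mem: zK => zbox S1; exists (ev z); split.
- by move=> v; have := zbox (enum_rank v); rewrite /= in_itv /= => /andP[].
- have [//|z0] := pselect (exists v, ev z v != 0); exfalso.
  move: S1; rewrite /= /power_sum big1 ?ler10 // => v _.
  have [->|zv] := eqVneq (ev z v) 0; first by rewrite expr0n gtn_eqF.
  by case: z0; exists v.
move=> y y0 [v yv].
pose m := [arg max_(u > v) y u]%O.
have my u : y u <= y m by rewrite /m; case: arg_maxP => // i _; apply.
have m0 : 0 < y m by apply: lt_le_trans (my v); rewrite lt_def yv y0.
have yE : y = (fun u => y m * (y u / y m)).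
  by apply/funext => u; rewrite mulrC divfK // gt_eqF.
have -> : edge_quotient H y = edge_quotient H (fun u => y u / y m).
  rewrite /edge_quotient -!/(edge_sum _) -!/(power_sum _) [in LHS]yE.
  by rewrite edge_sumZ power_sumZ -mulf_div divff ?mul1r // expf_neq0 // gt_eqF.
pose yy u := y u / y m.
have := zmax (\row_i yy (enum_val i)); rewrite /= ev_row; apply.
apply/mem_set/(@inK yy m); last by rewrite /yy divff // gt_eqF.
by move=> u; rewrite /yy divr_ge0 ?y0 //= ler_pdivrMr // mul1r.
Qed.

Lemma extremal_vector (v0 : V) : exists x M, [/\ forall v, 0 <= x v,
    exists v, x v != 0, edge_sum x = M * power_sum x,
    forall y, (forall v, 0 <= y v) -> edge_sum y <= M * power_sum y &
    r`!%:R * M <= spectral_radius R H].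
Proof.
have [x [x0 [v xv] xmax]] := quotient_max_exists v0.
have S0 := power_sum_gt0 x0 xv.
exists x, (edge_quotient H x); split=> //; first by exists v.
- by rewrite /edge_quotient divfK // gt_eqF.
- move=> y y0; have [[u yu]|y00] := pselect (exists u, y u != 0).
    have T0 := power_sum_gt0 y0 yu; rewrite -ler_pdivrMr //.
    by apply: xmax => //; exists u.
  rewrite (_ : y = fun u => 0 * 1) ?edge_sumZ ?power_sumZ ?expr0n ?gtn_eqF //.
    by rewrite !mul0r mulr0.
  apply/funext => u; rewrite mul0r; apply/eqP/negPn/negP => yu.
  by case: y00; exists u.
rewrite ler_wpM2l ?ler0n //; apply: ub_le_sup; last by exists x => //; split=> //; exists v.
by exists (edge_quotient H x) => _ [y [y0 yn] <-]; apply: xmax.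
Qed.

Lemma expr_increment n (h : R) : 0 <= h <= 1 -> (1 + h) ^+ n <= 1 + 3 ^+ n * h.
Proof.
case/andP=> h0 h1; elim: n => [|n IH]; first by rewrite !expr0 mul1r lerDl.
rewrite exprSr; apply: (@le_trans _ _ ((1 + 3 ^+ n * h) * (1 + h))).
  by apply: ler_wpM2r => //; lra.
have t1 : 1 <= 3 ^+ n :> R by apply: exprn_ege1; lra.
have t2 : 0 <= 3 ^+ n * h :> R by apply: mulr_ge0 => //; lra.
have t3 : (3 ^+ n * h) * h <= (3 ^+ n * h) * 1 by apply: ler_wpM2l.
have t4 : 1 * h <= 3 ^+ n * h by apply: ler_wpM2r.
by rewrite exprSr; lra.
Qed.

Section Maximizer.
Variables (x : V -> R) (M : R).
Hypotheses (x0 : forall v, 0 <= x v) (xM : edge_sum x = M * power_sum x).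
Hypothesis x_max : forall y, (forall v, 0 <= y v) ->
  edge_sum y <= M * power_sum y.

Lemma maximum_gt0 e : e \in edges H -> 0 < M.
Proof.
move=> eE; have := x_max (fun=> ler01).
have : 1 <= edge_sum (fun=> 1).
  rewrite /edge_sum (bigD1 e) //= big1 // lerDl.
  by apply: sumr_ge0 => f _; apply: prodr_ge0 => v _; apply: ler01.
move=> h1 /(le_trans h1); have := power_sum_ge0 (fun=> ler01).
case: ltP => // M0 S0; have : M * power_sum (fun=> 1) <= 0 by rewrite mulr_le0_ge0.
by move=> /[swap] h2 /(le_trans h2); rewrite ler10.
Qed.

(** Compare x with the vector where the coordinate at v is multiplied by 1 + h:
    the edge sum grows by h times the left-hand side, the power sum by x v
    ^+ r * ((1 + h) ^+ r - 1). Then let h tend to 0. *)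
Lemma maximum_label v :
  \sum_(e in edges H | v \in e) \prod_(u in e) x u <= r%:R * M * x v ^+ r.
Proof.
set D := \sum_(e in _ | _) _.
have key h : 0 < h -> D <= (M * x v ^+ r) * \sum_(i < r) (1 + h) ^+ i.
  move=> h0; pose y u := if u == v then (1 + h) * x v else x u.
  have y0 u : 0 <= y u by rewrite /y; case: ifP => // _; rewrite mulr_ge0 ?x0 //; lra.
  have yS : power_sum y = power_sum x + x v ^+ r * ((1 + h) ^+ r - 1).
    rewrite /power_sum (bigD1 v) //= [in RHS](bigD1 v) //= /y eqxx.
    rewrite (eq_bigr (fun u => x u ^+ r)) => [|u /negPf -> //].
    by rewrite exprMn; ring.
  have yP : edge_sum y = edge_sum x + h * D.
    rewrite /edge_sum (bigID [pred e : {set V} | v \in e]) /=.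
    rewrite [in RHS](bigID [pred e : {set V} | v \in e]) /= /D mulr_sumr.
    rewrite addrAC -big_split /=; congr (_ + _); apply: eq_bigr => e /andP[_ ve].
      rewrite (bigD1 v) //= [in RHS](bigD1 v) //= /y eqxx.
      rewrite (eq_bigr x) => [|u /andP[_ /negPf -> //]].
      by ring.
    by apply: eq_bigr => u ue; rewrite /y; case: eqP ve => // <-; rewrite ue.
  have := x_max y0; rewrite yS yP mulrDr -xM lerD2l subrX1 [1 + h - 1]addrAC.
  rewrite subrr add0r mulrA [M * _ * _]mulrCA ler_pM2l //.
have C0 : 0 <= M * x v ^+ r.
  have := key 1 ltr01.
  have D0 : 0 <= D by apply: sumr_ge0 => e _; apply: prodr_ge0.
  have s0 : 0 < \sum_(i < r) (1 + 1) ^+ i :> R.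
    case: (r) r_gt0 => // n _; rewrite big_ord_recl expr0 ltr_pwDl //.
    by apply: sumr_ge0 => i _; apply: exprn_ge0; lra.
  by move=> /(le_trans D0); rewrite pmulr_lge0.
have -> : r%:R * M * x v ^+ r = (M * x v ^+ r) * r%:R by ring.
set C := M * x v ^+ r in key C0 *.
pose T := \sum_(i < r) 3 ^+ i : R.
have T0 : 0 <= T by apply: sumr_ge0 => i _; apply: exprn_ge0.
apply/ler_addgt0Pr => eps eps0.
(* Chosen so that h <= 1 and C * T * h <= eps. *)
pose h := eps / (1 + C * T + eps).
have CT : 0 <= C * T by apply: mulr_ge0.
have den : 0 < 1 + C * T + eps by lra.
have h0 : 0 < h by rewrite divr_gt0.
have h1 : h <= 1 by rewrite ler_pdivrMr // mul1r; lra.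
apply: le_trans (key h h0) _.
have : \sum_(i < r) (1 + h) ^+ i <= r%:R + T * h.
  rewrite -[r in r%:R]card_ord -sum1_card natr_sum mulr_suml -big_split /=.
  by apply: ler_sum => i _; apply: expr_increment; rewrite h1 ltW.
move=> /(ler_wpM2l C0) /le_trans; apply; rewrite mulrDr lerD2l mulrA.
rewrite /h mulrA ler_pdivrMr // mulrC ler_pM2l //.
by lra.
Qed.

(** Otherwise some edge e has k zero coordinates with 0 < k < r. Raising them to
    a small t > 0 increases the edge sum by a term of order t ^+ k and the
    power sum only by a term of order t ^+ r. *)
Lemma maximum_positive : connected H -> (exists v, x v != 0) ->
  forall v, 0 < x v.
Proof.
move=> conn [v0 xv0].
have pos v : (0 < x v) = (x v != 0) by rewrite lt_def x0 andbT.
have step e v u : e \in edges H -> v \in e -> u \in e -> x v != 0 -> x u != 0.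
  move=> eE ve ue xv; apply/negP => xu.
  pose c := \prod_(w in e | x w != 0) x w.
  have c0 : 0 < c by apply: prodr_gt0 => w /andP[_]; rewrite -pos.
  pose k := #|[set w in e | x w == 0]|.
  have kr : (k < r)%N.
    rewrite -(uniform eE); apply: proper_card; apply/properP; split.
      by apply/subsetP => w; rewrite inE => /andP[].
    by exists v => //; rewrite inE (negbTE xv) andbF.
  have M0 := maximum_gt0 eE.
  have key t : 0 < t -> t <= 1 -> c <= M * k%:R * t.
    move=> t0 t1; pose y w := if (w \in e) && (x w == 0) then t else x w.
    have y0 w : 0 <= y w by rewrite /y; case: ifP => // _; rewrite ltW.
    have xy w : x w <= y w.
      by rewrite /y; case: ifP => // /andP[_ /eqP->]; rewrite ltW.
    have yS : power_sum y = power_sum x + k%:R * t ^+ r.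
      rewrite /power_sum (bigID [pred w | (w \in e) && (x w == 0)]) /=.
      rewrite [in RHS](bigID [pred w | (w \in e) && (x w == 0)]) /=.
      rewrite (eq_bigr (fun=> t ^+ r)) => [|w h]; last by rewrite /y h.
      rewrite [in RHS]big1 => [|w /andP[_ /eqP->]]; last by rewrite expr0n gtn_eqF.
      rewrite add0r addrC; congr (_ + _).
        by apply: eq_bigr => w /negPf h; rewrite /y h.
      by rewrite sumr_const mulr_natl; congr (_ *+ _); apply: eq_card => w; rewrite !inE.
    have yP : edge_sum x + c * t ^+ k <= edge_sum y.
      rewrite /edge_sum (bigD1 e) //= [in leRHS](bigD1 e) //=.
      rewrite (bigD1 u) //= (eqP xu) mul0r add0r addrC.
      apply: lerD.
        by apply: ler_sum => f _; apply: ler_prod => w _; rewrite x0 xy.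
      rewrite (bigID [pred w | x w == 0]) /= mulrC le_eqVlt; apply/orP; left.
      apply/eqP; congr (_ * _).
        rewrite (eq_bigr (fun=> t)) => [|w /andP[h1 h2]]; last by rewrite /y h1 h2.
        by rewrite prodr_const /k; congr (_ ^+ _); apply: eq_card => w; rewrite !inE.
      by apply: eq_bigr => w /andP[h1 /negPf h2]; rewrite /y h1 h2.
    have := x_max y0; rewrite yS mulrDr -xM => /(le_trans yP); rewrite lerD2l.
    have -> : t ^+ r = t ^+ k * t ^+ (r - k) by rewrite -exprD subnKC // ltnW.
    rewrite [t ^+ k * _]mulrC !mulrA ler_pM2r ?exprn_gt0 //.
    move=> /le_trans; apply; rewrite ler_wpM2l //.
      by rewrite mulr_ge0 ?ler0n // ltW.
    by rewrite -[leRHS]expr1; apply: ler_wiXn2l; rewrite ?subn_gt0 // ltW.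
  have : c <= 0; last by rewrite leNgt c0.
  apply/ler_addgt0Pr => eps eps0; pose q := M * k%:R.
  have q0 : 0 <= q by rewrite mulr_ge0 ?ler0n // ltW.
  have den : 0 < 1 + q + eps by lra.
  apply: le_trans (key (eps / (1 + q + eps)) _ _) _.
  - by rewrite divr_gt0.
  - by rewrite ler_pdivrMr // mul1r; lra.
  by rewrite -/q add0r mulrA ler_pdivrMr // mulrC ler_pM2l //; lra.
move=> v; rewrite pos; have [w [/and3P[wk _ _] <-]] := conn v0 v.
elim: w v0 xv0 wk => [|[e u] w IH] v0 xv0 //= /and4P[eE ve ue wk].
exact: (IH u (step _ _ _ eE ve ue xv0) wk).
Qed.

End Maximizer.
End Extremal.

Section ThresholdVector.
Local Open Scope ring_scope.
Variables (R : realType) (V : finType) (H : uhypergraph 4 V).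

Lemma threshold_vector e : e \in edges H -> connected H ->
  spectral_radius R H <= 6 * (2 + Num.sqrt 5) `^ (4^-1) ->
  exists (x : V -> R) (M : R), [/\ 0 < M, forall v, 0 < x v,
    forall v, \sum_(f in edges H | v \in f) \prod_(u in f) x u <=
      4 * M * x v ^+ 4 & (4 * M) ^+ 4 <= 2 + Num.sqrt 5].
Proof.
move=> eE conn; have /card_gt0P[v0 _] : (0 < #|e|)%N by rewrite (uniform eE).
have [x [M [x0 xn xM xmax hM]]] := @extremal_vector R 4 V H isT v0.
have M0 := maximum_gt0 xmax eE.
move=> hr; exists x, M; split=> //.
- exact: (maximum_positive _ x0 xM xmax conn xn).
- by move=> v; apply: maximum_label.
set th := (2 + Num.sqrt 5) `^ (4^-1) in hr.
have hth : 4 * M <= th.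
  move: (le_trans hM hr); rewrite (_ : 4`! = 24)%N //; lra.
have s0 : 0 <= 2 + Num.sqrt 5 :> R by rewrite addr_ge0 ?sqrtr_ge0.
have <- : th ^+ 4 = 2 + Num.sqrt 5.
  rewrite -powR_mulrn ?powR_ge0 // -powRrM.
  by rewrite (mulVf (_ : 4 != 0 :> R)) ?powRr1 // pnatr_eq0.
apply: lerXn2r => //; rewrite nnegrE ?powR_ge0 //.
by rewrite mulr_ge0 // ltW.
Qed.
End ThresholdVector.
(** * Irreducibility *)

(** If every edge had a vertex of degree one, removing one such vertex from each
    edge would present H as an extension. The edges remain distinct, because
    two of them never share r vertices. *)
Lemma irreducible_full_edge r (V : finType) (H : uhypergraph r.+1 V) :
  (forall e f, e \in edges H -> f \in edges H -> r <= #|e :&: f| -> e = f) ->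
  irreducible H ->
  exists2 F, F \in edges H & forall v, v \in F -> 1 < degree H v.
Proof.
move=> simple irr; have [//|none] := pselect (exists2 F, F \in edges H &
  forall v, v \in F -> 1 < degree H v).
case: irr.
have [c hc] : exists c : {set V} -> option V, forall e, e \in edges H ->
    exists v, [/\ c e = Some v, v \in e &
      forall f, f \in edges H -> v \in f -> f = e].
  apply: (@fin_all_exists _ _ (fun e o => e \in edges H -> exists v, [/\ o = Some v, v \in e &
      forall f, f \in edges H -> v \in f -> f = e])).
  move=> e; have [eE|eE] := boolP (e \in edges H); last by exists None.
  have [[v [ve dv]]|all] := pselect (exists v, v \in e /\ degree H v <= 1).
    exists (Some v) => _; exists v; split=> // f fE vf; apply/eqP/negPn/negP => fe.
    by move: dv; rewrite /degree (cardsD1 e) (cardsD1 f) !inE eE ve fE vf fe.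
  case: none; exists e => // v ve; rewrite ltnNge; apply/negP => dv.
  by case: all; exists v.
(* c selects a vertex of degree one in each edge; W keeps the vertices that are
   not selected, and tr is the trace of an edge on W. *)
pose C := [set v | [exists e in edges H, c e == Some v]].
pose W : finType := {v : V | v \notin C}.
pose tr (e : {set V}) : {set W} := [set w | val w \in e].
have val_tr e : e \in edges H -> val @: tr e = e :\: C.
  move=> eE; apply/setP => v; apply/imsetP/setDP => [[w]|[ve vC]].
    by rewrite inE => we ->; split=> //; apply: (valP w).
  by exists (Sub v vC); rewrite ?inE SubK.
have priv e v : e \in edges H -> v \in e -> v \in C -> c e = Some v.
  move=> eE ve; rewrite inE => /existsP[f /andP[fE /eqP cf]].
  have [v' [cf' vf only]] := hc f fE; move: cf'; rewrite cf => -[vv].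
  by rewrite -vv in only; rewrite (only e eE ve).
have cC e v : e \in edges H -> c e = Some v -> v \in C.
  by move=> eE ce; rewrite inE; apply/existsP; exists e; rewrite eE ce /=.
have card_tr e : e \in edges H -> #|tr e| = r.
  move=> eE; rewrite -(card_imset _ val_inj) val_tr //.
  have [v [ce ve _]] := hc e eE.
  have -> : e :\: C = e :\ v.
    apply/setP => u; rewrite !inE; case ue: (u \in e); rewrite ?andbF // !andbT.
    congr (~~ _); apply/idP/eqP => [uC|->]; last first.
      by have := cC e v eE ce; rewrite inE.
    have := priv e u eE ue; rewrite inE => /(_ uC); rewrite ce => -[].
    by [].
  by have := uniform eE; rewrite (cardsD1 v) ve => -[].
have tr_inj e f : e \in edges H -> f \in edges H -> tr e = tr f -> e = f.
  move=> eE fE ef; apply: simple => //; rewrite -(card_tr e eE).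
  rewrite -(card_imset _ val_inj) val_tr //; apply: subset_leq_card.
  apply/subsetP => v /setDP[ve vC]; rewrite inE ve /=.
  have : (Sub v vC : W) \in tr f by rewrite -ef inE SubK.
  by rewrite inE SubK.
have K_unif (e' : {set W}) : e' \in tr @: edges H -> #|e'| = r.
  by case/imsetP=> e eE ->; apply: card_tr.
exists W, (UHypergraph K_unif).
set K := UHypergraph K_unif.
have trE e : e \in edges H -> tr e \in edges K by move=> eE; apply: imset_f.
have [h hK] : exists h : {e' | e' \in edges K} -> {set V},
    forall e', h e' \in edges H /\ tr (h e') = val e'.
  apply: (@fin_all_exists _ _ (fun e' o => o \in edges H /\ tr o = val e')).
  by case=> e' /= /imsetP[e eE e'e]; exists e; rewrite e'e.
have [p hp] : exists p : {e' | e' \in edges K} -> V,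
    forall e', c (h e') = Some (p e').
  apply: (@fin_all_exists _ _ (fun e' o => c (h e') = Some o)) => e'.
  by have [v [cv _ _]] := hc _ (hK e').1; exists v.
pose back (x : extension_vertex K) : V :=
  match x with inl w => val w | inr e' => p e' end.
have pC e' : p e' \in C by apply: cC (hp e'); case: (hK e').
have p_in e' : p e' \in h e'.
  by have [v [cv ve _]] := hc _ (hK e').1; move: cv; rewrite hp => -[->].
have g_inj : injective back.
  case=> [w|e'] [w'|f'] /= eq_g.
  - by congr inl; apply: val_inj.
  - by have := svalP w; rewrite /= eq_g pC.
  - by have := svalP w'; rewrite /= -eq_g pC.
  congr inr; apply: val_inj; case: (hK e') => h1 <-; case: (hK f') => h2 <-.
  have [v [cv ve only]] := hc _ h2.
  have := only (h e') h1; move: cv; rewrite hp => -[<-].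
  by rewrite -eq_g p_in => /(_ isT) ->.
have g_surj v : exists x, back x = v.
  have [vC|vC] := boolP (v \in C); last by exists (inl (Sub v vC)); apply: SubK.
  have := vC; rewrite inE => /existsP[e /andP[eE /eqP ce]].
  exists (inr (exist _ (tr e) (trE e eE))) => /=.
  set e' := exist _ _ _; have [h1 h2] := hK e'.
  have := hp e'; rewrite (tr_inj _ _ h1 eE h2) ce => -[].
  by [].
have [f fK] : exists f, forall v, back (f v) = v by
  apply: (@fin_all_exists _ _ (fun v x => back x = v)).
have fg : cancel back f by move=> x; apply: g_inj; rewrite fK.
have g_edge e' : back @: extended_edge e' = h e'.
  have [h1 h2] := hK e'; rewrite /extended_edge imsetU1 /= -imset_comp -h2.
  rewrite (_ : [set _ | w in _] = val @: tr (h e')); last by apply: eq_imset.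
  rewrite val_tr //; apply/setP => v; rewrite in_setU1 in_setD.
  apply/orP/idP => [[/eqP->|/andP[]]|ve] //.
  have [vC|vC] := boolP (v \in C); last by right.
  by left; have := priv _ _ h1 ve vC; rewrite hp => -[->].
have f_edge e' : f @: h e' = extended_edge e'.
  by rewrite -g_edge -imset_comp (eq_imset (g := id)) ?imset_id // => x; apply: fg.
exists f; first by exists back.
rewrite /= /extension_edges; apply/setP => X; apply/imsetP/imsetP.
  by case=> e' _ ->; exists (h e'); [case: (hK e')|rewrite f_edge].
case=> e eE ->; pose e' : {e' | e' \in edges K} := exist _ (tr e) (trE e eE).
exists e' => //; rewrite -f_edge; have [h1 h2] := hK e'.
by rewrite (tr_inj _ _ h1 eE h2).
Qed.
(** * The structure theorem *)

(** The label of v in f is the share of f in the eigenvector equation at v for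
    the extremal vector x, with eigenvalue 4 * M. *)
Lemma threshold_subnormal (R : realType) (V : finType) (H : uhypergraph 4 V) e :
  e \in edges H -> connected H ->
  (spectral_radius R H <= 6 * (2 + Num.sqrt 5) `^ (4^-1))%R ->
  exists B, subnormal H ((Num.sqrt 5 - 1) / 2 : R)%R B.
Proof.
move=> eE conn /(threshold_vector eE conn)[x [M [M0 x0 xM hM]]].
exists (fun v (f : {set V}) => (\prod_(u in f) x u) / (4 * M * x v ^+ 4))%R.
have s5 : (Num.sqrt 5 * Num.sqrt 5 = 5 :> R)%R by rewrite -expr2 sqr_sqrtr // ler0n.
have s0 : (0 <= Num.sqrt 5 :> R)%R by apply: sqrtr_ge0.
have s2 : (2 < Num.sqrt 5 :> R)%R.
  rewrite ltNge; apply/negP => s2.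
  have : (Num.sqrt 5 * Num.sqrt 5 <= 2 * 2 :> R)%R by apply: ler_pM.
  by rewrite s5; lra.
have p0 f : (0 < \prod_(u in f) x u)%R by apply: prodr_gt0.
have d0 v : (0 < 4 * M * x v ^+ 4)%R by rewrite mulr_gt0 ?exprn_gt0 // mulr_gt0.
split.
- by lra.
- have -> : ((Num.sqrt 5 - 1) / 2 * ((Num.sqrt 5 - 1) / 2) =
    (Num.sqrt 5 * Num.sqrt 5 - 2 * Num.sqrt 5 + 1) / 4 :> R)%R by field.
  by rewrite s5; field.
- by move=> v f _ _; rewrite divr_gt0.
- by move=> v; rewrite -mulr_suml ler_pdivrMr // mul1r.
move=> f fE; set p := (\prod_(u in f) x u)%R.
have -> : (\prod_(v in f) (p / (4 * M * x v ^+ 4)) = ((4 * M) ^+ 4)^-1)%R.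
  rewrite big_split /= prodr_const (uniform fE) prodfV big_split /=.
  rewrite prodr_const (uniform fE) prodrXl -/p invfM mulrCA divff ?mulr1 //.
  by rewrite expf_neq0 // gt_eqF // p0.
rewrite -[leRHS]div1r ler_pdivlMr; last by rewrite exprn_gt0 // mulr_gt0.
have -> : (2 * ((Num.sqrt 5 - 1) / 2) - 1 = Num.sqrt 5 - 2 :> R)%R by field.
have : ((Num.sqrt 5 - 2) * (4 * M) ^+ 4 <=
    (Num.sqrt 5 - 2) * (2 + Num.sqrt 5))%R by apply: ler_wpM2l; lra.
have -> : ((Num.sqrt 5 - 2) * (2 + Num.sqrt 5) =
    Num.sqrt 5 * Num.sqrt 5 - 4 :> R)%R by ring.
by rewrite s5; move: (_ ^+ 4)%R => D; lra.
Qed.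

(** At a common vertex of e and f the two labels have product at most 1 / 4,
    whereas (1 / 4) ^+ 3 is less than alpha ^+ 2. *)
Lemma subnormal_meet (R : realFieldType) (V : finType) (H : uhypergraph 4 V)
    (g : R) B : subnormal H g B ->
  forall e f, e \in edges H -> f \in edges H -> 3 <= #|e :&: f| -> e = f.
Proof.
move=> L e f eE fE; rewrite cardE; case D: (enum _) => [|a [|b [|c l]]] // _.
apply/eqP/negPn/negP => ef.
have U : uniq [:: a; b; c].
  have := enum_uniq (e :&: f); rewrite D /= !inE !negb_or.
  by case/and4P=> /and3P[-> -> _] /andP[-> _] _ _.
have mem x : x \in [:: a; b; c] -> (x \in e) && (x \in f).
  move=> xs; have : x \in enum (e :&: f).
    by rewrite D -[[:: a, b, c & l]]/([:: a; b; c] ++ l) mem_cat xs.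
  by rewrite mem_enum in_setI.
have [/andP[ae af] /andP[be bf] /andP[ce cf]] :
    [/\ (a \in e) && (a \in f), (b \in e) && (b \in f) & (c \in e) && (c \in f)].
  by split; apply: mem; rewrite !inE eqxx ?orbT.
have half x : x \in e -> x \in f -> (0 <= B x e * B x f <= 1 / 4)%R.
  move=> xe xf; have fe : f != e by rewrite eq_sym.
  have h := label_sum2 L eE fE xe xf fe.
  have h1 := label_gt0 L eE xe; have h2 := label_gt0 L fE xf.
  have h3 := sqr_ge0 (B x e - B x f)%R.
  have h4 : ((B x e + B x f) * (B x e + B x f) <= 1 * 1)%R by apply: ler_pM => //; lra.
  apply/andP; split; first by rewrite mulr_ge0 // ltW.
  by move: h3 h4; rewrite expr2 !(mulrDl, mulrDr, mulrBl, mulrBr); lra.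
have /andP[g1 g2] := golden_bounds L.
have he := label_prod3 L eE ae be ce U; have hf := label_prod3 L fE af bf cf U.
have /andP[a0 a1] := half a ae af; have /andP[b0 b1] := half b be bf.
have /andP[c0 c1] := half c ce cf.
have : ((2 * g - 1) * (2 * g - 1) <=
    (B a e * B b e * B c e) * (B a f * B b f * B c f))%R.
  by apply: ler_pM => //; lra.
have -> : ((B a e * B b e * B c e) * (B a f * B b f * B c f) =
  (B a e * B a f) * (B b e * B b f) * (B c e * B c f))%R by ring.
have : ((B a e * B a f) * (B b e * B b f) * (B c e * B c f) <=
    1 / 4 * (1 / 4) * (1 / 4))%R.
  by apply: ler_pM => //; [apply: mulr_ge0|apply: ler_pM].
have : (1 / 5 * (1 / 5) <= (2 * g - 1) * (2 * g - 1))%R by apply: ler_pM => //; lra.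
by move=> h1 h2 h3; have := le_trans h1 (le_trans h3 h2); lra.
Qed.

Theorem theorem2 (R : realType) (V : finType) (H : uhypergraph 4 V)
  (Hirr : irreducible H) (Hconn : connected H)
  (Hrho : (spectral_radius R H <= 6 * (2 + Num.sqrt 5) `^ (4^-1))%R) :
  [/\ hypertree H,
      forall v, degree H v <= 3,
      forall e, e \in edges H -> #|incident_edges H e| <= 4
    & open_quipu H \/
      ([\/ is_dagger H 1 2 2 2, is_dagger H 1 2 2 3,
           is_dagger H 1 1 4 4 | is_dagger H 1 1 4 5] \/
       exists k l, 1 <= k <= 3 /\ k <= l /\ is_dagger H 1 1 k l) ].
Proof.
have simple e f : e \in edges H -> f \in edges H -> 3 <= #|e :&: f| -> e = f.
  move=> eE; have [B L] := threshold_subnormal eE Hconn Hrho.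
  exact: (subnormal_meet L).
have [F FE F_deg] := irreducible_full_edge simple Hirr.
have [B L] := threshold_subnormal FE Hconn Hrho.
exact: (rooted_structure L FE F_deg Hconn).
Qed.
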